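(* Let $\Omega\subset\mathbb{C}^n$ be a bounded domain, let $z\in\Omega$, and let $X=\sum_{j=1}^n X_j\,\partial/\partial z_j$ be a nonzero holomorphic tangent vector. Let $$S_{z,X}:=\{f\in A^2(\Omega): f(z)=0,\ Xf(z)=0\},$$ a closed linear subspace of $A^2(\Omega)$, and let $P_{z,X}$ be the orthogonal projection from $A^2(\Omega)$ onto $S_{z,X}^\perp$, the orthogonal complement of $S_{z,X}$ in $A^2(\Omega)$. Let $b_z:=K_\Omega(\cdot,z)/\sqrt{K_\Omega(z)}$, and let $c_{z,X}\in\mathcal{O}(\Omega)$ be any function satisfying $c_{z,X}(z)=0$, $|c_{z,X}|<1$ on $\Omega$ and $Xc_{z,X}(z)=C_\Omega(z;X)$. Then $$B_\Omega(z;X)=\frac{C_\Omega(z;X)}{\|P_{z,X}(b_z c_{z,X})\|_{L^2(\Omega)}}.$$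
   Context: $\mathcal{O}(\Omega)$ denotes the holomorphic functions on $\Omega$. $L^2(\Omega)$ is taken with respect to Lebesgue measure, and $A^2(\Omega)=L^2(\Omega)\cap\mathcal{O}(\Omega)$ is the Bergman space with the $L^2$ inner product. $K_\Omega(\zeta,z)=\sum_{j\ge 0}h_j(\zeta)\overline{h_j(z)}$ is the Bergman kernel, where $\{h_j\}$ is any complete orthonormal basis of $A^2(\Omega)$, and $K_\Omega(z):=K_\Omega(z,z)$. For $X=\sum_j X_j\,\partial/\partial z_j$ with $X_j\in\mathbb{C}$ and $f$ holomorphic, $Xf(z)=\sum_j X_j\frac{\partial f}{\partial z_j}(z)$. The Bergman metric and Carathéodory metric are $$B_\Omega(z;X)=\frac{1}{\sqrt{K_\Omega(z)}}\max\{|Xf(z)|: f\in\mathcal{O}(\Omega),\ f(z)=0,\ \|f\|_{L^2(\Omega)}\le 1\},$$ $$C_\Omega(z;X)=\max\{|Xf(z)|: f\in\mathcal{O}(\Omega),\ f(z)=0,\ |f|<1\}.$$ A function $c_{z,X}$ as in the claim exists but need not be unique. *)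

(* Defs.v *)
From HB Require Import structures.
From mathcomp Require Import all_boot all_order all_algebra.
From mathcomp Require Import complex.
From mathcomp Require Import all_classical all_reals all_analysis.

Set Implicit Arguments.
Unset Strict Implicit.
Unset Printing Implicit Defensive.

Import Order.TTheory GRing.Theory Num.Theory.
Import numFieldNormedType.Exports.
Import ComplexField.Normc.

Local Open Scope classical_set_scope.
Local Open Scope complex_scope.
Local Open Scope ring_scope.

(* [R[i]] as a normed space over itself; the norm on ['rV[R[i]]_n] is then the
   sup norm, which gives the usual topology and bounded sets of C^n. *)
HB.instance Definition _ (R : realType) := NormedModule.copy R[i] (R[i])^o.

Section LebesgueMeasure.
Variable R : realType.

(* Real coordinates of a point of C: [(Re, Im)]. *)
Notation plane := (measurableTypeR R * measurableTypeR R)%type.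

Definition tcons n
    (p : n.-tuple plane * measurableTypeR R * measurableTypeR R) :
    n.+1.-tuple plane :=
  [tuple of (p.1.2, p.2) :: p.1.1].

Lemma measurable_tcons n : measurable_fun setT (@tcons n).
Proof.
apply: measurable_cons; first apply: measurable_fun_pair => //.
- exact: measurableT_comp.
- exact: measurableT_comp.
Qed.

Section LebesgueStep.
Variables (n : nat) (m : {measure set (n.-tuple plane) -> \bar R}).

Definition lebesgue_step : set (n.+1.-tuple plane) -> \bar R :=
  pushforward ((m \x @lebesgue_measure R) \x @lebesgue_measure R)%E (@tcons n).

Let lebesgue_step0 : lebesgue_step set0 = 0%E.
Proof. by rewrite /lebesgue_step /pushforward preimage_set0 measure0. Qed.

Let lebesgue_step_ge0 A : (0 <= lebesgue_step A)%E.
Proof. exact: (measure_ge0 (_ \x _)%E). Qed.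

Let lebesgue_step_sigma_additive : semi_sigma_additive lebesgue_step.
Proof.
exact: (@measure_semi_sigma_additive _ _ _
  (measure_function_pushforward__canonical__measure_function_Measure
    ((m \x @lebesgue_measure R) \x @lebesgue_measure R)%E (@measurable_tcons n))).
Qed.

HB.instance Definition _ := isMeasure.Build _ _ _ lebesgue_step
  lebesgue_step0 lebesgue_step_ge0 lebesgue_step_sigma_additive.

End LebesgueStep.

(* Lebesgue measure on C^n = R^(2n), as a product of 2n copies of the one on R. *)
Fixpoint lebesgue_Cn n : {measure set (n.-tuple plane) -> \bar R} :=
  if n is n'.+1 then lebesgue_step (lebesgue_Cn n') else \d_[tuple].

Definition cpoint n (t : n.-tuple plane) : 'rV[R[i]]_n :=
  \row_j ((tnth t j).1 +i* (tnth t j).2).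

End LebesgueMeasure.

Section BergmanSpace.
Variables (R : realType) (n : nat).
Notation C := R[i].
Notation Cn := 'rV[R[i]]_n.
Implicit Types (Omega : set Cn) (f g p : Cn -> C) (X z w : Cn)
  (S M : set (Cn -> C)).

Definition bounded_domain Omega :=
  [/\ open Omega, connected Omega, Omega !=set0 & bounded_set Omega].

Definition holomorphic Omega f := forall z, Omega z -> differentiable f z.

Definition tangent X f z : C := \sum_(j < n) X ord0 j * 'D_('e_j) f z.

(* Functions are total on C^n; only their values on [Omega] matter below. *)
Definition L2norm Omega f : \bar R :=
  ('N[@lebesgue_Cn R n]_2%:E
    [EFin \o ((fun t => normc (f (cpoint t))) \_ (@cpoint R n @^-1` Omega))])%E.

Definition L2 Omega f :=
  [/\ measurable_fun (@cpoint R n @^-1` Omega) (fun t => complex.Re (f (cpoint t))),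
      measurable_fun (@cpoint R n @^-1` Omega) (fun t => complex.Im (f (cpoint t)))
    & (L2norm Omega f < +oo)%E].

Definition A2 Omega : set (Cn -> C) :=
  [set f | L2 Omega f /\ holomorphic Omega f].

Definition L2dot Omega f g : C :=
  let D := @cpoint R n @^-1` Omega in
  let h t := f (cpoint t) * (g (cpoint t))^*%C in
  (\int[@lebesgue_Cn R n]_(t in D) complex.Re (h t)) +i*
  (\int[@lebesgue_Cn R n]_(t in D) complex.Im (h t)).

Definition complete_orthonormal_basis Omega (h : nat -> Cn -> C) :=
  [/\ forall j, A2 Omega (h j),
      forall j k, L2dot Omega (h j) (h k) = (j == k)%:R
    & forall f, A2 Omega f -> forall e : R, 0 < e ->
        exists N (a : nat -> C),
          (L2norm Omega (fun w => (f w - \sum_(0 <= j < N) a j * h j w)%R)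
            < e%:E)%E].

Definition bergman_kernel (h : nat -> Cn -> C) (w z : Cn) : C :=
  limn (series (fun j => h j w * (h j z)^*%C)).

(* [K(z, z)], which is real. *)
Definition bergman_diag h z : R := complex.Re (bergman_kernel h z z).

(* On a bounded domain both suprema below are maxima. *)
Definition bergman_metric Omega h z X : R :=
  (Num.sqrt (bergman_diag h z))^-1 *
  sup [set normc (tangent X f z) | f in
        [set f | [/\ holomorphic Omega f, f z = 0 & (L2norm Omega f <= 1)%E]]].

Definition caratheodory_metric Omega z X : R :=
  sup [set normc (tangent X f z) | f in
        [set f | [/\ holomorphic Omega f, f z = 0
                   & forall w, Omega w -> normc (f w) < 1]]].

Definition S_space Omega z X : set (Cn -> C) :=
  [set f | [/\ A2 Omega f, f z = 0 & tangent X f z = 0]].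

Definition orthocomplement Omega S : set (Cn -> C) :=
  [set g | A2 Omega g /\ forall f, S f -> L2dot Omega g f = 0].

(* The element of [M] whose difference with [f] is orthogonal to [M]. *)
Definition orthoproj Omega M f : Cn -> C :=
  xget (cst 0) [set p | M p /\
    forall m, M m -> L2dot Omega (fun w => f w - p w) m = 0].

Definition P_proj Omega z X : (Cn -> C) -> Cn -> C :=
  orthoproj Omega (orthocomplement Omega (S_space Omega z X)).

Definition b_fun h z : Cn -> C :=
  fun w => bergman_kernel h w z / (Num.sqrt (bergman_diag h z))%:C.

End BergmanSpace.

(* Main.v *)
Require Import Defs.
From HB Require Import structures.
From mathcomp Require Import all_boot all_order all_algebra.
From mathcomp Require Import complex.
From mathcomp Require Import all_classical all_reals all_analysis.
From mathcomp Require Import measurable_realfun.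
From mathcomp Require Import ring lra.

Set Implicit Arguments.
Unset Strict Implicit.
Unset Printing Implicit Defensive.

Import Order.TTheory GRing.Theory Num.Theory.
Import numFieldNormedType.Exports.
Import ComplexField.Normc.

Local Open Scope classical_set_scope.
Local Open Scope complex_scope.
Local Open Scope ring_scope.

(** Let p be the projection of b c onto the orthogonal complement of
    S = {f : f(z) = 0, X f(z) = 0}.
Then b c - p lies in S, and c(z) = 0, so that p(z) = 0 and
    X p(z) = b(z) X c(z) = sqrt(K(z)) C(z;X).
If f is in the Bergman space and f(z) = 0, put lambda = X f(z) / X p(z).  The
difference f - lambda p lies in S, hence is orthogonal to p, and therefore
|lambda| ||p|| <= ||f||, with equality for f = p.  So the largest value of
|X f(z)| with f(z) = 0 and ||f|| <= 1 is sqrt(K(z)) C(z;X) / ||p||, which is the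
claim.  This is [bergman_metric_formula].

Behind these lines is the fact that f |-> f(z) and f |-> X f(z) are inner
products with elements of the Bergman space.  It makes S the orthogonal
complement of two vectors, so that the projection can be written down by
Gram-Schmidt ([projection_exists]) and b c - p can be seen to lie in S.  The
element representing a bounded functional l is the sum of the series
h_j conj(l(h_j)) ([riesz]); for the evaluation at z it is K(.,z).  Two facts make
this work: evaluations and directional derivatives are bounded in the L^2 norm
([deriv_bound]), and L^2-Cauchy sequences of holomorphic functions have
holomorphic limits ([holo_limit]), with norms controlled by Fatou's lemma
([sqnorm_fatou]).

Both facts come from the theory of one complex variable, for functions that are
merely differentiable at each point: Goursat's theorem for rectangles
([goursat]), Cauchy's formula on the boundary of a square ([cauchy_formula]), and
two consequences with explicit constants.  One is a second-order Taylor estimate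
([taylor_estimate]); it is uniform over complex lines, so it passes to limits and
yields total differentiability of the limit.  The other is a sub-mean value
inequality over a solid square ([plane_submean]); squares rather than discs make
it compatible with a product of one-dimensional Lebesgue measures, and Tonelli's
theorem turns it into one over boxes in C^n ([tuple_submean]).

Boundedness of the domain makes both sides nonzero.  The constant 1 is square
integrable, whence K(z) > 0; scaled coordinate functions compete for the
Caratheodory metric, whence C(z;X) > 0, and then X p(z) > 0 shows that p is
nonzero. *)

(** * The modulus on R[i] and epsilon-delta forms of continuity and differentiability *)

Section ComplexNorm.
Variable R : realType.
Notation C := R[i].
Implicit Types z w : C.

Lemma norm_normc z : `|z| = (normc z)%:C. Proof. by []. Qed.

Lemma normc_ge0 z : 0 <= normc z.
Proof. by case: z => a b; exact: sqrtr_ge0. Qed.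

Lemma gt0_realc z : 0 < z -> z = (complex.Re z)%:C /\ 0 < complex.Re z.
Proof. by case: z => a b; rewrite ltcE /= => /andP[/eqP -> ]. Qed.

Lemma normc_sqr z : normc z ^+ 2 = complex.Re z ^+ 2 + complex.Im z ^+ 2.
Proof. by case: z => a b; rewrite /= sqr_sqrtr ?addr_ge0 ?sqr_ge0. Qed.

Lemma normc_Re z : `|complex.Re z| <= normc z.
Proof. by have := normc_ge_Re z; rewrite norm_normc lecR. Qed.

Lemma normc_Im z : `|complex.Im z| <= normc z.
Proof.
rewrite -(@ler_pXn2r _ 2%N) ?nnegrE ?normc_ge0//.
by rewrite normc_sqr real_normK ?num_real// lerDr sqr_ge0.
Qed.

Lemma normc_le_ReIm z : normc z <= `|complex.Re z| + `|complex.Im z|.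
Proof.
rewrite -(@ler_pXn2r _ 2%N) ?nnegrE ?normc_ge0 ?addr_ge0//.
rewrite normc_sqr -(real_normK (num_real (complex.Re z))).
rewrite -(real_normK (num_real (complex.Im z))).
have := normr_ge0 (complex.Re z); have := normr_ge0 (complex.Im z); nra.
Qed.

Lemma normc_real (x : R) : normc x%:C = `|x|.
Proof. by rewrite /= expr0n /= addr0 sqrtr_sqr. Qed.

Lemma normc_i : normc ('i : C) = 1.
Proof. by rewrite /= expr0n expr1n /= add0r sqrtr1. Qed.

Lemma le_normcB z w : normc (z - w) <= normc z + normc w.
Proof. by rewrite (le_trans (le_normcD _ _))// normcN. Qed.

Lemma normc_eq0 z : (normc z == 0) = (z == 0).
Proof. by apply/eqP/eqP => [/eq0_normc//|->]; rewrite normc0. Qed.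

Lemma normc_gt0 z : (0 < normc z) = (z != 0).
Proof. by rewrite lt_def normc_ge0 andbT normc_eq0. Qed.

Lemma distcC z w : normc (z - w) = normc (w - z).
Proof. by rewrite -normcN opprB. Qed.

Lemma conjcD z w : (z + w)^*%C = z^*%C + w^*%C.
Proof. exact: rmorphD. Qed.

Lemma conjcM z w : (z * w)^*%C = z^*%C * w^*%C.
Proof. exact: rmorphM. Qed.

Lemma normc_conj z : normc z^*%C = normc z.
Proof. by case: z => x y; rewrite /normc /= sqrrN. Qed.

Lemma mulc_conj z : z * z^*%C = (normc z ^+ 2)%:C.
Proof. by rewrite -sqr_normc norm_normc -rmorphXn. Qed.

End ComplexNorm.

Section EpsilonDelta.
Variable R : realType.
Notation C := R[i].

Lemma diff_eps (V : normedModType C) (f : V -> C) z : differentiable f z ->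
  forall e : R, 0 < e -> exists2 d : R, 0 < d & forall v : V, `|v| < d%:C ->
   `|f (v + z) - f z - 'd f z v| <= e%:C * `|v|.
Proof.
move=> /diff_locallyP [_ H] e e0.
have : \forall v \near (0:V), `|f (v + z) - f z - 'd f z v| <= e%:C * `|v|.
  move/eqaddoP : H => /(_ (e%:C)).
  rewrite ltcR => /(_ e0); apply: filterS => v /=.
  by rewrite !fctE /= opprD addrA.
move=> /nbhs_ballP[d /= /gt0_realc[-> d0] H1].
exists (complex.Re d) => // v hv; apply: H1.
by rewrite -ball_normE /= sub0r normrN.
Qed.

(** The converse of [diff_eps], phrased with a candidate derivative: this is how the
differentiability of a limit of holomorphic functions is established. *)
Lemma eps_diff (V : normedModType C) (f : V -> C) (L : {linear V -> C}) z :
  continuous L ->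
  (forall e : R, 0 < e -> exists2 d : R, 0 < d & forall v : V, `|v| < d%:C ->
   `|f (v + z) - f z - L v| <= e%:C * `|v|) ->
  differentiable f z /\ ('d f z = L :> (V -> C)).
Proof.
move=> cL H.
have H2 : f \o shift z = cst (f z) + L +o_ (0:V) id.
  apply/eqaddoP => e /gt0_realc[-> e0]; have [d d0 Hd] := H _ e0.
  apply/nbhs_ballP; exists d%:C; first by rewrite /= ltcR.
  move=> v; rewrite -ball_normE /= sub0r normrN => /Hd.
  by rewrite !fctE /= opprD addrA.
have H3 := @diff_unique _ V _ f L z cL H2.
split; last exact: H3.
apply/diff_locallyP; rewrite H3; split; [exact: cL|exact: H2].
Qed.

Lemma continuous_eps (f : C -> C) z : {for z, continuous f} ->
  forall e : R, 0 < e -> exists2 d : R, 0 < d &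
    forall w, normc (w - z) < d -> normc (f w - f z) < e.
Proof.
move=> /cvgrPdist_lt H e e0.
have /nbhs_ballP[d /= /gt0_realc[-> d0] Hd] := H e%:C ltac:(by rewrite ltcR).
exists (complex.Re d) => // w hw.
have : `|f z - f w| < e%:C.
  by apply: Hd; rewrite -ball_normE /= norm_normc ltcR distcC.
by rewrite norm_normc ltcR distcC.
Qed.

Lemma continuous_line (f : C -> C) (p : R -> C) (x : R) :
  (forall y, normc (p y - p x) = `|y - x|) -> {for p x, continuous f} ->
  {for x, continuous (fun y => complex.Re (f (p y)))} /\
  {for x, continuous (fun y => complex.Im (f (p y)))}.
Proof.
move=> Hp /continuous_eps cf; split.
  apply/cvgrPdist_lt => e e0; have [d d0 Hd] := cf _ e0.
  apply/nbhs_ballP; exists d => //= y hy; have {}hy : `|y - x| < d by rewrite distrC.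
  rewrite distrC -raddfB /=.
  by apply: le_lt_trans (normc_Re _) _; apply: Hd; rewrite Hp.
apply/cvgrPdist_lt => e e0; have [d d0 Hd] := cf _ e0.
apply/nbhs_ballP; exists d => //= y hy; have {}hy : `|y - x| < d by rewrite distrC.
rewrite distrC -raddfB /=.
by apply: le_lt_trans (normc_Im _) _; apply: Hd; rewrite Hp.
Qed.

End EpsilonDelta.

Section SegmentIntegral.
Variable R : realType.
Notation C := R[i].
Notation mu := (@lebesgue_measure R).
Implicit Types (a b x : R) (f g : R -> C).

(** The integral of a complex function over a real segment, taken componentwise. *)
Definition segint a b f : C :=
  (\int[mu]_(x in `[a, b]) complex.Re (f x)) +i*
  (\int[mu]_(x in `[a, b]) complex.Im (f x)).

Definition ccont a b f := forall x, x \in `[a, b] ->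
  {for x, continuous (fun y => complex.Re (f y))} /\
  {for x, continuous (fun y => complex.Im (f y))}.

Lemma ccont_int a b f : ccont a b f ->
  mu.-integrable `[a, b] (EFin \o (fun y => complex.Re (f y))) /\
  mu.-integrable `[a, b] (EFin \o (fun y => complex.Im (f y))).
Proof.
move=> cf; split; apply: continuous_compact_integrable;
  try exact: segment_compact;
  apply: continuous_in_subspaceT => x /set_mem xab; by have [] := cf x xab.
Qed.

Lemma ccont_sub a b c d f : a <= c -> d <= b -> ccont a b f -> ccont c d f.
Proof.
move=> ac db cf x; rewrite in_itv /= => /andP[h1 h2]; apply: cf.
by rewrite in_itv /= (le_trans ac)//= (le_trans h2).
Qed.

Lemma eq_segint a b f g : (forall x, x \in `[a, b] -> f x = g x) ->
  segint a b f = segint a b g.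
Proof.
by move=> fg; congr (_ +i* _); apply: eq_Rintegral => x /set_mem/fg ->.
Qed.

Lemma segintD a b f g : ccont a b f -> ccont a b g ->
  segint a b (fun x => f x + g x) = segint a b f + segint a b g.
Proof.
move=> /ccont_int[f1 f2] /ccont_int[g1 g2].
rewrite /segint [in RHS]/GRing.add /=; congr (_ +i* _); rewrite -RintegralD//;
  by apply: eq_Rintegral => x _; rewrite raddfD.
Qed.

Lemma segintZ a b (k : C) f : ccont a b f ->
  segint a b (fun x => k * f x) = k * segint a b f.
Proof.
move=> /ccont_int[f1 f2].
case: k => k1 k2; rewrite /segint [in RHS]/GRing.mul /=.
have i1 (k : R) : mu.-integrable `[a, b]
    (EFin \o (fun y => k * complex.Re (f y))).
  by apply: (integrableZl _ k f1).
have i2 (k : R) : mu.-integrable `[a, b]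
    (EFin \o (fun y => k * complex.Im (f y))).
  by apply: (integrableZl _ k f2).
congr (_ +i* _).
- rewrite -!RintegralZl// -RintegralB//.
  by apply: eq_Rintegral => x _; case: (f x).
- rewrite -!RintegralZl// -RintegralD//.
  by apply: eq_Rintegral => x _; case: (f x).
Qed.

Lemma ccontZ a b (k : C) f : ccont a b f -> ccont a b (fun x => k * f x).
Proof.
case: k => k1 k2 cf x xab; have [c1 c2] := cf x xab; split.
  rewrite (_ : (fun y => _) =
    (fun y => k1 * complex.Re (f y) - k2 * complex.Im (f y))).
    by apply: cvgB; apply: cvgM => //; exact: cvg_cst.
  by apply/funext => y; case: (f y).
rewrite (_ : (fun y => _) =
  (fun y => k1 * complex.Im (f y) + k2 * complex.Re (f y))).
  by apply: cvgD; apply: cvgM => //; exact: cvg_cst.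
by apply/funext => y; case: (f y).
Qed.

Lemma segintB a b f g : ccont a b f -> ccont a b g ->
  segint a b (fun x => f x - g x) = segint a b f - segint a b g.
Proof.
move=> cf cg; rewrite -mulN1r -(segintZ _ cg) -segintD; [|exact: cf|exact: ccontZ].
by apply: eq_segint => x _; rewrite mulN1r.
Qed.

Lemma segint_cst a b (k : C) : a <= b -> segint a b (fun=> k) = k * (b - a)%:C.
Proof.
move=> ab; rewrite /segint !Rintegral_cst//=; case: k => k1 k2.
rewrite lebesgue_measure_itv /= lte_fin.
rewrite [in RHS]/GRing.mul /=; move: ab; rewrite le_eqVlt => /predU1P[->|ab].
  by rewrite ltxx subrr !mulr0 subr0 addr0.
by rewrite ab /= !mulr0 subr0 add0r.
Qed.

Lemma segint_split a b c f : a <= b -> b <= c -> ccont a c f ->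
  segint a c f = segint a b f + segint b c f.
Proof.
move=> ab bc /ccont_int[f1 f2]; rewrite /segint [in RHS]/GRing.add /=.
have key (h : R -> R) : mu.-integrable `[a, c] (EFin \o h) ->
   \int[mu]_(x in `[a, c]) h x =
   \int[mu]_(x in `[a, b]) h x + \int[mu]_(x in `[b, c]) h x.
  move=> ih; have := @Rintegral_itvB R h (BLeft a) (BRight c) b ih ab bc.
  rewrite Rintegral_itv_obnd_cbnd.
    by move=> <-; rewrite addrC subrK.
  apply: integrableS ih => //; apply: subset_itvr => //.
by congr (_ +i* _); exact: key.
Qed.

Lemma segint_bound a b f (M : R) : a <= b -> ccont a b f ->
  (forall x, x \in `[a, b] -> normc (f x) <= M) ->
  normc (segint a b f) <= 2 * M * (b - a).
Proof.
move=> ab /ccont_int[f1 f2] fM.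
have key (h : R -> R) : mu.-integrable `[a, b] (EFin \o h) ->
   (forall x, x \in `[a, b] -> `|h x| <= M) ->
   `|\int[mu]_(x in `[a, b]) h x| <= M * (b - a).
  move=> ih hM; apply: le_trans (le_normr_Rintegral _ ih) _ => //.
  apply: (@le_trans _ _ (\int[mu]_(x in `[a, b]) M)).
    apply: le_Rintegral => //.
      exact: (integrable_norm ih).
    by apply: continuous_compact_integrable => //;
      [exact: segment_compact|move=> ?; exact: cvg_cst].
  rewrite Rintegral_cst//= lebesgue_measure_itv /= lte_fin.
  move: ab; rewrite le_eqVlt => /predU1P[->|->]//=.
  by rewrite ltxx subrr mulr0.
rewrite (le_trans (normc_le_ReIm _))//= -mulrA mulr_natl mulr2n lerD//; apply: key => // x xab.
  by rewrite (le_trans (normc_Re _))// fM.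
by rewrite (le_trans (normc_Im _))// fM.
Qed.

End SegmentIntegral.

(** * Rectangle integrals and Goursat's theorem *)

Local Arguments normc : simpl never.

Section Rectangle.
Variable R : realType.
Notation C := R[i].
Implicit Types (a b c d x y : R) (q : C -> C).

(** The integral of q(z) dz over the positively oriented boundary of
[a, b] x [c, d]. *)
Definition rectint a b c d q : C :=
  segint a b (fun x => q (x +i* c)) - segint a b (fun x => q (x +i* d)) +
  'i * (segint c d (fun y => q (b +i* y)) - segint c d (fun y => q (a +i* y))).

Definition onrect a b c d (z : C) : bool :=
  (a <= complex.Re z <= b) && (c <= complex.Im z <= d).

Lemma differentiable_idC (z : C) : differentiable (fun w : C => w : C) z.
Proof. by apply/derivable1_diffP; exact: derivable_id. Qed.

Lemma contB (q l : C -> C) (z : C) : {for z, continuous q} ->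
  {for z, continuous l} -> {for z, continuous (fun w => q w - l w)}.
Proof. by move=> cq cl; exact: (@continuousB C C C q l z cq cl). Qed.

Lemma ccont_h q a b c :
  (forall x, x \in `[a, b] -> {for x +i* c, continuous q}) ->
  ccont a b (fun x => q (x +i* c)).
Proof.
move=> H x /H; apply: (@continuous_line _ q (fun x => x +i* c)) => y.
by rewrite /normc /= subrr expr0n addr0 sqrtr_sqr.
Qed.

Lemma ccont_v q a c d :
  (forall y, y \in `[c, d] -> {for a +i* y, continuous q}) ->
  ccont c d (fun y => q (a +i* y)).
Proof.
move=> H x /H; apply: (@continuous_line _ q (fun y => a +i* y)) => y.
by rewrite /normc /= subrr expr0n add0r sqrtr_sqr.
Qed.

Local Arguments rectint : simpl never.

(** The two copies of the new vertical side cancel; this is why continuity is asked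
on the horizontal sides only. *)
Lemma rectint_split_x q a e b c d : a <= e -> e <= b ->
  (forall x y, x \in `[a, b] -> y \in [:: c; d] -> {for x +i* y, continuous q}) ->
  rectint a b c d q = rectint a e c d q + rectint e b c d q.
Proof.
move=> ae eb H; rewrite /rectint.
have Hy y : y \in [:: c; d] -> ccont a b (fun x => q (x +i* y)).
  by move=> yin; apply: ccont_h => x xab; exact: H.
rewrite (segint_split ae eb (Hy c _)) ?mem_head//.
rewrite (segint_split ae eb (Hy d _)) ?inE ?eqxx ?orbT//.
by ring.
Qed.

Lemma rectint_split_y q a b c e d : c <= e -> e <= d ->
  (forall x y, x \in [:: a; b] -> y \in `[c, d] -> {for x +i* y, continuous q}) ->
  rectint a b c d q = rectint a b c e q + rectint a b e d q.
Proof.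
move=> ce ed H; rewrite /rectint.
have Hx x : x \in [:: a; b] -> ccont c d (fun y => q (x +i* y)).
  by move=> xin; apply: ccont_v => y yab; exact: H.
rewrite (segint_split ce ed (Hx a _)) ?mem_head//.
rewrite (segint_split ce ed (Hx b _)) ?inE ?eqxx ?orbT//.
by ring.
Qed.

(** Continuity of q along each of the four sides, one restriction per side: this is
exactly what linearity of the four integrals uses. *)
Definition bdcont a b c d q :=
  [/\ ccont a b (fun x => q (x +i* c)), ccont a b (fun x => q (x +i* d)),
      ccont c d (fun y => q (b +i* y)) & ccont c d (fun y => q (a +i* y))].

Definition onbd a b c d (z : C) : bool :=
  onrect a b c d z &&
  [|| complex.Re z == a, complex.Re z == b, complex.Im z == c | complex.Im z == d].

Lemma bdcontP a b c d q : a <= b -> c <= d ->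
  (forall z, onbd a b c d z -> {for z, continuous q}) -> bdcont a b c d q.
Proof.
move=> ab cd H; split; [apply: ccont_h|apply: ccont_h|apply: ccont_v|apply: ccont_v] => t;
  rewrite in_itv /= => tab; apply: H;
  by rewrite /onbd /onrect /= ?tab ?lexx ?eqxx ?ab ?cd ?orbT.
Qed.

Lemma rectint_B a b c d q r : bdcont a b c d q -> bdcont a b c d r ->
  rectint a b c d (fun z => q z - r z) = rectint a b c d q - rectint a b c d r.
Proof.
move=> [q1 q2 q3 q4] [r1 r2 r3 r4]; rewrite /rectint.
by rewrite (segintB q1 r1) (segintB q2 r2) (segintB q3 r3) (segintB q4 r4); ring.
Qed.

Lemma rectint_Z a b c d k q : bdcont a b c d q ->
  rectint a b c d (fun z => k * q z) = k * rectint a b c d q.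
Proof.
move=> [q1 q2 q3 q4]; rewrite /rectint.
by rewrite (segintZ _ q1) (segintZ _ q2) (segintZ _ q3) (segintZ _ q4); ring.
Qed.

Lemma eq_rectint a b c d q r : a <= b -> c <= d ->
  (forall z, onbd a b c d z -> q z = r z) ->
  rectint a b c d q = rectint a b c d r.
Proof.
move=> ab cd H; rewrite /rectint; congr (_ - _ + _ * (_ - _)); apply: eq_segint => t;
  rewrite in_itv /= => tab; apply: H;
  by rewrite /onbd /onrect /= ?tab ?lexx ?eqxx ?ab ?cd ?orbT.
Qed.

Lemma rectint_bound a b c d q (M : R) : a <= b -> c <= d -> bdcont a b c d q ->
  (forall z, onbd a b c d z -> normc (q z) <= M) ->
  normc (rectint a b c d q) <= 4 * M * ((b - a) + (d - c)).
Proof.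
move=> ab cd [q1 q2 q3 q4] H; rewrite /rectint.
have B1 := @segint_bound _ a b _ M ab q1; have B2 := @segint_bound _ a b _ M ab q2.
have B3 := @segint_bound _ c d _ M cd q3; have B4 := @segint_bound _ c d _ M cd q4.
apply: le_trans (le_normcD _ _) _; rewrite normcM normc_i mul1r.
apply: le_trans (lerD (le_normcB _ _) (le_normcB _ _)) _.
suff : normc (segint a b (fun x => q (x +i* c))) +
  normc (segint a b (fun x => q (x +i* d))) +
 (normc (segint c d (fun y => q (b +i* y))) +
  normc (segint c d (fun y => q (a +i* y)))) <=
  2 * M * (b - a) + 2 * M * (b - a) + (2 * M * (d - c) + 2 * M * (d - c)).
  by move=> /le_trans; apply; rewrite le_eqVlt; apply/orP; left; apply/eqP; ring.
by apply: lerD; apply: lerD; [apply: B1|apply: B2|apply: B3|apply: B4] => t;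
  rewrite in_itv /= => tab; apply: H;
  rewrite /onbd /onrect /= ?tab ?lexx ?eqxx ?ab ?cd ?orbT.
Qed.

(** Opposite sides differ by a constant, so only integrals of constants occur. *)
Lemma rectint_affine a b c d (k l : C) : a <= b -> c <= d ->
  rectint a b c d (fun z => k + l * z) = 0.
Proof.
move=> ab cd; rewrite /rectint.
have cl (s t : R) : ccont s t (fun=> k : C).
  by move=> x _; split; exact: cvg_cst.
have H : bdcont a b c d (fun z => k + l * z).
  apply: bdcontP => // z _; apply: differentiable_continuous.
  apply: differentiableD; first exact: differentiable_cst.
  by apply: differentiableM; [exact: differentiable_cst|exact: differentiable_idC].
case: H => q1 q2 q3 q4.
rewrite -(segintB q1 q2) -(segintB q3 q4).
rewrite (@eq_segint _ a b _ (fun=> l * (0 +i* (c - d)))).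
  rewrite (@eq_segint _ c d _ (fun=> l * (b - a)%:C)).
    rewrite !segint_cst//.
    case: l {q1 q2 q3 q4} => l1 l2; apply/eqP; rewrite eq_complex /=.
    by apply/andP; split; apply/eqP; ring.
  move=> x _; case: l {q1 q2 q3 q4} => l1 l2; case: k {cl} => k1 k2.
  apply/eqP; rewrite eq_complex /=.
  by apply/andP; split; apply/eqP; ring.
move=> x _; case: l {q1 q2 q3 q4} => l1 l2; case: k {cl} => k1 k2.
apply/eqP; rewrite eq_complex /=.
by apply/andP; split; apply/eqP; ring.
Qed.

Lemma diff_eps1 q (z : C) : differentiable q z -> exists L : C,
  forall e : R, 0 < e -> exists2 d : R, 0 < d & forall w, normc (w - z) < d ->
   normc (q w - q z - L * (w - z)) <= e * normc (w - z).
Proof.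
move=> dq; exists ('d q z 1) => e e0.
have [d d0 Hd] := diff_eps dq e0; exists d => // w hw.
have {}hw : `|w - z| < d%:C by rewrite -ltcR in hw; exact: hw.
have dE : 'd q z (w - z) = 'd q z 1 * (w - z).
  by rewrite -[w - z in LHS]mulr1 linearZ /= mulrC.
have := Hd _ hw; rewrite subrK dE => H.
by rewrite -lecR rmorphM; exact: H.
Qed.

Lemma onbd_rect a b c d z : onbd a b c d z -> onrect a b c d z.
Proof. by case/andP. Qed.

Section Goursat.
Variables (a b c d : R) (q : C -> C).
Hypotheses (ab : a <= b) (cd : c <= d).
Hypothesis dq : forall z, onrect a b c d z -> differentiable q z.

Let wd k : R := (b - a) / 2 ^+ k.
Let ht k : R := (d - c) / 2 ^+ k.
Let Jk k (p : R * R) := rectint p.1 (p.1 + wd k) p.2 (p.2 + ht k) q.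
Let eta := normc (rectint a b c d q).
Let good k (p : R * R) := [/\ a <= p.1, p.1 + wd k <= b, c <= p.2,
  p.2 + ht k <= d & eta <= 4 ^+ k * normc (Jk k p)].

Let wd_ge0 k : 0 <= wd k. Proof. by rewrite divr_ge0 ?exprn_ge0 ?subr_ge0. Qed.
Let ht_ge0 k : 0 <= ht k. Proof. by rewrite divr_ge0 ?exprn_ge0 ?subr_ge0. Qed.
Let wdS k : wd k = wd k.+1 + wd k.+1.
Proof. by rewrite /wd exprS; field; rewrite expf_neq0. Qed.
Let htS k : ht k = ht k.+1 + ht k.+1.
Proof. by rewrite /ht exprS; field; rewrite expf_neq0. Qed.

Let goodcont k p x y : good k p -> x \in `[p.1, p.1 + wd k] ->
  y \in `[p.2, p.2 + ht k] -> {for x +i* y, continuous q}.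
Proof.
move=> [h1 h2 h3 h4 _]; rewrite !in_itv /= => /andP[x1 x2] /andP[y1 y2].
apply/differentiable_continuous/dq; rewrite /onrect /=.
by rewrite (le_trans h1)// (le_trans x2)// (le_trans h3)// (le_trans y2).
Qed.

Let step k p : good k p -> exists p', [/\ good k.+1 p',
  p.1 <= p'.1, p'.1 + wd k.+1 <= p.1 + wd k,
  p.2 <= p'.2 & p'.2 + ht k.+1 <= p.2 + ht k].
Proof.
move=> gp; have [h1 h2 h3 h4 h5] := gp.
have w0 := wd_ge0 k.+1; have t0 := ht_ge0 k.+1.
have wS := wdS k; have tS := htS k.
set w := wd k.+1 in w0 wS *; set t := ht k.+1 in t0 tS *.
have split4 : Jk k p = Jk k.+1 p + Jk k.+1 (p.1, p.2 + t) +
   (Jk k.+1 (p.1 + w, p.2) + Jk k.+1 (p.1 + w, p.2 + t)).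
  rewrite /Jk /= -/w -/t wS tS.
  have cc x y : p.1 <= x <= p.1 + wd k -> p.2 <= y <= p.2 + ht k ->
      {for x +i* y, continuous q}.
    by move=> hx hy; apply: (goodcont gp); rewrite in_itv.
  rewrite (@rectint_split_x _ _ (p.1 + w)); last 3 first.
  - lra.
  - lra.
  - move=> x y; rewrite in_itv /= !inE => /andP[x1 x2] /orP[]/eqP ->;
      apply: cc; apply/andP; lra.
  rewrite (@rectint_split_y _ _ _ _ (p.2 + t)); last 3 first.
  - lra.
  - lra.
  - move=> x y; rewrite in_itv /= !inE => /orP[]/eqP -> /andP[x1 x2];
      apply: cc; apply/andP; lra.
  rewrite (@rectint_split_y _ (p.1 + w) _ _ (p.2 + t)); last 3 first.
  - lra.
  - lra.
  - move=> x y; rewrite in_itv /= !inE => /orP[]/eqP -> /andP[x1 x2];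
      apply: cc; apply/andP; lra.
  by rewrite [p.1 + (w + w)]addrA [p.2 + (t + t)]addrA.
have : 4 ^+ k * normc (Jk k p) <= 4 ^+ k * (normc (Jk k.+1 p) +
    normc (Jk k.+1 (p.1, p.2 + t)) + (normc (Jk k.+1 (p.1 + w, p.2)) +
    normc (Jk k.+1 (p.1 + w, p.2 + t)))).
  rewrite ler_pM2l ?exprn_gt0// split4.
  apply: le_trans (le_normcD _ _) _.
  by apply: lerD; apply: le_normcD.
move=> /(le_trans h5) h6.
have fin x y : p.1 <= x -> x + w <= p.1 + wd k ->
   p.2 <= y -> y + t <= p.2 + ht k ->
   eta <= 4 * (4 ^+ k * normc (Jk k.+1 (x, y))) ->
   exists p', [/\ good k.+1 p', p.1 <= p'.1, p'.1 + w <= p.1 + wd k,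
   p.2 <= p'.2 & p'.2 + t <= p.2 + ht k].
  move=> g1 g2 g3 g4 g5; exists (x, y).
  split; [|exact: g1|exact: g2|exact: g3|exact: g4].
  split; [exact: le_trans g1|exact: le_trans h2|exact: le_trans g3
    |exact: le_trans h4|by rewrite exprS -mulrA].
move: h6; rewrite !mulrDr; set A := _ * normc (Jk k.+1 p).
set B := _ * normc _; set D := _ * normc _; set E := _ * normc _ => h6.
have wle : w <= wd k by rewrite wS lerDl.
have tle : t <= ht k by rewrite tS lerDl.
have [hA|hA] := leP eta (4 * A).
  by apply: (fin p.1 p.2); rewrite ?lexx ?lerD2l.
have [hB|hB] := leP eta (4 * B).
  by apply: (fin p.1 (p.2 + t)); rewrite ?lexx ?lerDl ?lerD2l// -addrA -tS.
have [hD|hD] := leP eta (4 * D).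
  by apply: (fin (p.1 + w) p.2); rewrite ?lexx ?lerDl ?lerD2l// -addrA -wS.
have hE : eta <= 4 * E by lra.
by apply: (fin (p.1 + w) (p.2 + t)); rewrite ?lexx ?lerDl ?lerD2l// -addrA -?wS -?tS.
Qed.

(** The supremum of the left ends lies in every interval. *)
Lemma nested_point (u w : nat -> R) : (forall k, u k <= u k.+1) ->
  (forall k, u k.+1 + w k.+1 <= u k + w k) -> (forall k, 0 <= w k) ->
  exists x, forall k, u k <= x <= u k + w k.
Proof.
move=> u1 u2 w0; exists (sup (range u)).
have um m n : u m <= u (m + n)%N.
  by elim: n => [|n IH]; rewrite ?addn0// addnS (le_trans IH).
have wm m n : u (m + n)%N + w (m + n)%N <= u m + w m.
  by elim: n => [|n IH]; rewrite ?addn0// addnS (le_trans _ IH).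
have ub k n : u n <= u k + w k.
  have [/subnKC kn|/ltnW/subnKC nk] := leqP k n.
    by have := wm k (n - k)%N; rewrite kn; have := w0 n; lra.
  by have := um n (k - n)%N; rewrite nk; have := w0 k; lra.
move=> k; apply/andP; split.
  apply: ub_le_sup; last by exists k.
  by exists (u 0%N + w 0%N) => _ [n _ <-].
apply: ge_sup; first by exists (u 0%N); exists 0%N.
by move=> _ [n _ <-].
Qed.

(** Quadrisection.  One quarter always keeps a fourth of the integral, so after k
steps a rectangle of size 2^-k carries at least 4^-k eta.  These rectangles
shrink to a point where q differs from an affine map by a small multiple of the
distance; affine maps integrate to zero, and distance times perimeter is of order
4^-k as well, with a small constant. *)
Lemma goursat : rectint a b c d q = 0.
Proof.
apply/eqP; rewrite -normc_eq0 eq_le normc_ge0 andbT leNgt; apply/negP.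
rewrite -/eta => eta0.
have /choice[nxt Hn] : forall kp : nat * (R * R), exists p',
   good kp.1 kp.2 -> [/\ good kp.1.+1 p',
   kp.2.1 <= p'.1, p'.1 + wd kp.1.+1 <= kp.2.1 + wd kp.1,
   kp.2.2 <= p'.2 & p'.2 + ht kp.1.+1 <= kp.2.2 + ht kp.1].
  move=> kp.
  have [/step[p' Hp']|ng] := pselect (good kp.1 kp.2); first by exists p'.
  by exists kp.2.
pose fix u k : R * R := if k is k'.+1 then nxt (k', u k') else (a, c).
have ug k : good k (u k).
  elim: k => [|k IH]; last by have [] := Hn (k, u k) IH.
  rewrite /good /Jk /wd /ht /= !expr0 !divr1 mul1r.
  have -> : a + (b - a) = b by ring.
  have -> : c + (d - c) = d by ring.
  by split; rewrite ?lexx.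
have ust k := Hn (k, u k) (ug k).
have [x Hx] : exists x, forall k, (u k).1 <= x <= (u k).1 + wd k.
  by apply: nested_point => // k; have [] := ust k.
have [y Hy] : exists y, forall k, (u k).2 <= y <= (u k).2 + ht k.
  by apply: nested_point => // k; have [] := ust k.
have pin : onrect a b c d (x +i* y).
  have [h1 h2 h3 h4 _] := ug 0%N; have /andP[x1 x2] := Hx 0%N.
  have /andP[y1 y2] := Hy 0%N.
  by rewrite /onrect /=; apply/andP; split; apply/andP; lra.
have [L HL] := diff_eps1 (dq pin).
pose s := (b - a) + (d - c).
have s0 : 0 <= s by rewrite addr_ge0 ?subr_ge0.
(* The tolerance makes 4 e s^2 strictly smaller than eta. *)
have e0 : 0 < eta / (4 * s ^+ 2 + 1).
  by rewrite divr_gt0// ltr_wpDl// mulr_ge0// sqr_ge0.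
have [dl dl0 Hd] := HL _ e0.
set e := eta / _ in e0 Hd.
have [k Hk] : exists k, s / 2 ^+ k < dl.
  have sd0 : 0 <= s / dl by rewrite divr_ge0// ltW.
  exists (Num.bound (s / dl)); rewrite ltr_pdivrMr ?exprn_gt0//.
  rewrite -ltr_pdivrMl// mulrC (lt_le_trans (archi_boundP sd0))//.
  by rewrite -natrX ler_nat ltnW// ltn_expl.
have [h1 h2 h3 h4 h5] := ug k; have /andP[x1 x2] := Hx k.
have /andP[y1 y2] := Hy k.
have w0 := wd_ge0 k; have t0 := ht_ge0 k.
have wt : wd k + ht k = s / 2 ^+ k by rewrite -mulrDl.
set p := x +i* y in pin HL Hd.
set w := wd k in x2 h2 w0 wt; set t := ht k in y2 h4 t0 wt.
have near_p z : onrect (u k).1 ((u k).1 + w) (u k).2 ((u k).2 + t) z ->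
    normc (z - p) <= s / 2 ^+ k.
  case: z => z1 z2; rewrite /onrect /= => /andP[/andP[zx1 zx2] /andP[zy1 zy2]].
  apply: le_trans (normc_le_ReIm _) _ => /=; rewrite -wt; apply: lerD;
    rewrite ler_norml; apply/andP; lra.
have cq z : onbd (u k).1 ((u k).1 + w) (u k).2 ((u k).2 + t) z ->
    {for z, continuous q}.
  case: z => z1 z2 /andP[/andP[/= /andP[zx1 zx2] /andP[zy1 zy2]] _].
  by apply: (goodcont (ug k)); rewrite in_itv /=; apply/andP.
have wle : (u k).1 <= (u k).1 + w by rewrite lerDl.
have tle : (u k).2 <= (u k).2 + t by rewrite lerDl.
have bq := bdcontP wle tle cq.
pose l z : C := (q p - L * p) + L * z.
have cl z : {for z, continuous l}.
  apply: differentiable_continuous.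
  apply: differentiableD; first exact: differentiable_cst.
  by apply: differentiableM; [exact: differentiable_cst|exact: differentiable_idC].
have bl := bdcontP wle tle (fun z _ => cl z).
have br : bdcont (u k).1 ((u k).1 + w) (u k).2 ((u k).2 + t)
    (fun z => q z - l z).
  by apply: bdcontP => [||z hz]; [exact: wle|exact: tle|exact: contB (cq z hz) (cl z)].
have JE : Jk k (u k) =
   rectint (u k).1 ((u k).1 + w) (u k).2 ((u k).2 + t) (fun z => q z - l z).
  by rewrite (rectint_B bq bl) (rectint_affine _ _ wle tle) subr0.
have JB : normc (Jk k (u k)) <= 4 * (e * (s / 2 ^+ k)) * (s / 2 ^+ k).
  rewrite JE.
  have bd z : onbd (u k).1 ((u k).1 + w) (u k).2 ((u k).2 + t) z ->
      normc (q z - l z) <= e * (s / 2 ^+ k).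
    move=> /onbd_rect/near_p hz.
    have -> : q z - l z = q z - q p - L * (z - p) by rewrite /l; ring.
    apply: le_trans (Hd _ (le_lt_trans hz Hk)) _.
    by rewrite ler_wpM2l// ltW.
  have JB0 := rectint_bound wle tle br bd.
  have rE : ((u k).1 + w - (u k).1) + ((u k).2 + t - (u k).2) = s / 2 ^+ k.
    by rewrite -wt; ring.
  by rewrite rE in JB0.
have : eta <= e * (4 * s ^+ 2).
  apply: (le_trans h5); apply: le_trans (ler_wpM2l _ JB) _.
    by rewrite exprn_ge0.
  have -> : (4 : R) ^+ k = 2 ^+ k * 2 ^+ k by rewrite -exprMn; congr (_ ^+ _); ring.
  rewrite le_eqVlt; apply/orP; left; apply/eqP; field.
  by rewrite expf_neq0.
rewrite leNgt => /negP; apply.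
rewrite /e mulrAC ltr_pdivrMr ?ltr_wpDl// ?mulr_ge0 ?sqr_ge0//.
by rewrite mulrDr mulr1 ltrDl.
Qed.
End Goursat.

End Rectangle.

(** * Rectangles with a hole, and the integral of 1 / (z - z0) *)

Local Arguments rectint : simpl never.

Local Ltac complex_ring := apply/eqP; rewrite eq_complex; apply/andP;
  split; apply/eqP => /=; ring.

Section Cauchy.
Variable R : realType.
Notation C := R[i].
Implicit Types (a b c d x y s : R) (q g : C -> C) (z t : C).

Lemma diff_quot g k t z : differentiable g z -> z != t ->
  differentiable (fun w : C => (g w - k) / (w - t)) z.
Proof.
move=> dg zt; apply: differentiableM.
  by apply: differentiableB => //; exact: differentiable_cst.
apply: differentiableV; last by rewrite subr_eq0.
by apply: differentiableB; [exact: differentiable_idC|exact: differentiable_cst].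
Qed.

Lemma diff_inv t z : z != t -> differentiable (fun w : C => (w - t)^-1) z.
Proof.
move=> zt; apply: differentiableV; last by rewrite subr_eq0.
by apply: differentiableB; [exact: differentiable_idC|exact: differentiable_cst].
Qed.

(** Cutting along the sides of the hole leaves the hole and rectangles on which
Goursat's theorem applies. *)
Lemma rectint_hole a b c d a' b' c' d' q :
  a <= a' -> a' <= b' -> b' <= b -> c <= c' -> c' <= d' -> d' <= d ->
  (forall z, onrect a b c d z ->
     ~~ ((a' < complex.Re z < b') && (c' < complex.Im z < d')) ->
     differentiable q z) ->
  rectint a b c d q = rectint a' b' c' d' q.
Proof.
move=> aa ab bb cc cd dd dq.
have cq x y : a <= x <= b -> c <= y <= d ->
    ~~ ((a' < x < b') && (c' < y < d')) -> {for x +i* y, continuous q}.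
  by move=> hx hy hn; apply/differentiable_continuous/dq; rewrite /onrect /= ?hx ?hy.
have hc x y : a <= x <= b -> y \in [:: c; d] -> {for x +i* y, continuous q}.
  move=> hx; rewrite !inE => /orP[]/eqP->; apply: cq => //; lra.
have vc x y : x = a' \/ x = b' -> c <= y <= d -> {for x +i* y, continuous q}.
  by move=> [->|->] hy; apply: cq => //; lra.
have [cd' ab' cd2] : [/\ c <= d, a <= b' & c <= d'] by split; lra.
have [ab2 cd3 ab3] : [/\ a' <= b, c' <= d & a <= b] by split; lra.
have zero (u v w t : R) : a <= u -> u <= v -> v <= b -> c <= w -> w <= t -> t <= d ->
   [\/ v <= a', b' <= u, t <= c' | d' <= w] -> rectint u v w t q = 0.
  move=> h1 h2 h3 h4 h5 h6 h7; apply: goursat => // z /andP[/andP[z1 z2] /andP[z3 z4]].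
  apply: dq; first by rewrite /onrect; lra.
  by rewrite negb_and !negb_and -!leNgt; case: h7 => h7; lra.
rewrite (@rectint_split_x _ _ _ a'); last 3 first.
- lra.
- lra.
- by move=> x y; rewrite in_itv /= => hx; apply: hc; lra.
have -> : rectint a a' c d q = 0 by apply: zero => //; constructor 1.
rewrite add0r.
rewrite (@rectint_split_x _ _ _ b'); last 3 first.
- lra.
- lra.
- by move=> x y; rewrite in_itv /= => hx; apply: hc; lra.
have -> : rectint b' b c d q = 0 by apply: zero => //; constructor 2.
rewrite addr0.
rewrite (@rectint_split_y _ _ a' b' c c'); last 3 first.
- lra.
- lra.
- by move=> x y; rewrite in_itv /= !inE => /orP[]/eqP-> hx; apply: vc => //; [left|right].
have -> : rectint a' b' c c' q = 0 by apply: zero => //; constructor 3.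
rewrite add0r.
rewrite (@rectint_split_y _ _ a' b' c' d'); last 3 first.
- lra.
- lra.
- by move=> x y; rewrite in_itv /= !inE => /orP[]/eqP-> hx; apply: vc; lra.
have -> : rectint a' b' d' d q = 0 by apply: zero => //; constructor 4.
by rewrite addr0.
Qed.

Definition sqint (z0 : C) s q :=
  rectint (complex.Re z0 - s) (complex.Re z0 + s)
    (complex.Im z0 - s) (complex.Im z0 + s) q.

Definition onsq (z0 : C) s z :=
  (`|complex.Re (z - z0)| <= s) && (`|complex.Im (z - z0)| <= s).

Definition insq (z0 : C) s z :=
  (`|complex.Re (z - z0)| < s) && (`|complex.Im (z - z0)| < s).

Lemma onsqE z0 s z : onrect (complex.Re z0 - s) (complex.Re z0 + s)
    (complex.Im z0 - s) (complex.Im z0 + s) z = onsq z0 s z.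
Proof.
case: z z0 => z1 z2 [c1 c2]; rewrite /onrect /onsq /= !ler_norml.
by apply/idP/idP => H; lra.
Qed.

Lemma onbd_sq z0 s z : 
  onbd (complex.Re z0 - s) (complex.Re z0 + s)
    (complex.Im z0 - s) (complex.Im z0 + s) z -> onsq z0 s z && ~~ insq z0 s z.
Proof.
rewrite /onbd onsqE => /andP[-> ] /=.
case: z z0 => z1 z2 [c1 c2]; rewrite /insq /= negb_and -!leNgt !ler_normr.
by move=> /or4P[]/eqP ->; lra.
Qed.

Lemma notinsq_normc z0 s z : ~~ insq z0 s z -> s <= normc (z - z0).
Proof.
rewrite /insq negb_and -!leNgt => /orP[] /le_trans; apply;
  [exact: normc_Re|exact: normc_Im].
Qed.

Lemma bdcont_sq z0 s q : 0 <= s ->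
  (forall z, onsq z0 s z -> ~~ insq z0 s z -> {for z, continuous q}) ->
  bdcont (complex.Re z0 - s) (complex.Re z0 + s)
    (complex.Im z0 - s) (complex.Im z0 + s) q.
Proof.
move=> s0 H; apply: bdcontP => [||z /onbd_sq/andP[]]; [lra|lra|exact: H].
Qed.

Lemma sqint_bound z0 s q M : 0 <= s ->
  (forall z, onsq z0 s z -> ~~ insq z0 s z -> {for z, continuous q}) ->
  (forall z, onsq z0 s z -> ~~ insq z0 s z -> normc (q z) <= M) ->
  normc (sqint z0 s q) <= 16 * M * s.
Proof.
move=> s0 cq H; rewrite /sqint.
have h1 : complex.Re z0 - s <= complex.Re z0 + s by lra.
have h2 : complex.Im z0 - s <= complex.Im z0 + s by lra.
have B := @rectint_bound _ _ _ _ _ q M h1 h2 (bdcont_sq s0 cq).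
apply: le_trans (B _) _; last by lra.
by move=> z /onbd_sq/andP[]; exact: H.
Qed.

Lemma sqint_B z0 s q r : 0 <= s ->
  (forall z, onsq z0 s z -> ~~ insq z0 s z -> {for z, continuous q}) ->
  (forall z, onsq z0 s z -> ~~ insq z0 s z -> {for z, continuous r}) ->
  sqint z0 s (fun z => q z - r z) = sqint z0 s q - sqint z0 s r.
Proof. by move=> s0 cq cr; apply: rectint_B; exact: bdcont_sq. Qed.

Lemma sqint_Z z0 s k q : 0 <= s ->
  (forall z, onsq z0 s z -> ~~ insq z0 s z -> {for z, continuous q}) ->
  sqint z0 s (fun z => k * q z) = k * sqint z0 s q.
Proof. by move=> s0 cq; apply: rectint_Z; exact: bdcont_sq. Qed.

Lemma eq_sqint z0 s q r : 0 <= s ->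
  (forall z, onsq z0 s z -> ~~ insq z0 s z -> q z = r z) ->
  sqint z0 s q = sqint z0 s r.
Proof.
move=> s0 H; apply: eq_rectint => [||z /onbd_sq/andP[]]; [lra|lra|exact: H].
Qed.

Lemma invc_def (x y : R) :
  (x +i* y)^-1 = (x / (x ^+ 2 + y ^+ 2)) -i* (y / (x ^+ 2 + y ^+ 2)).
Proof. by []. Qed.

(** This is 2 i pi. *)
Definition kappa z0 s := sqint z0 s (fun z => (z - z0)^-1).

Lemma insq_center z0 s : 0 < s -> insq z0 s z0.
Proof. by move=> s0; rewrite /insq subrr /= normr0 s0. Qed.

Lemma notin_neq z0 s t z : insq z0 s t -> ~~ insq z0 s z -> z != t.
Proof. by move=> ht; apply: contraNneq => ->. Qed.

(** The contributions of opposite sides combine into the integral of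
2 s / (x^2 + s^2) over an interval of length 2 s, where the integrand is at least
1 / s. *)
Lemma kappa_ge4 z0 s : 0 < s -> 4 <= normc (kappa z0 s).
Proof.
move=> s0.
have s0' : 0 <= s by rewrite ltW.
have cq z : onsq z0 s z -> ~~ insq z0 s z ->
    {for z, continuous (fun w : C => (w - z0)^-1)}.
  move=> _ hz; apply/differentiable_continuous/diff_inv.
  exact: notin_neq (insq_center z0 s0) hz.
have [q1 q2 q3 q4] := bdcont_sq s0' cq.
pose k (c x : R) := 2 * s / ((x - c) ^+ 2 + s ^+ 2).
have ck c : continuous (k c).
  move=> x; apply: cvgM; first exact: cvg_cst.
  apply: cvgV; first by rewrite gt_eqF// ltr_wpDl ?sqr_ge0// exprn_gt0.
  apply: cvgD; last exact: cvg_cst.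
  apply: cvgM; by apply: cvgB; [exact: cvg_id|exact: cvg_cst].
have lk c : 2 <= \int[@lebesgue_measure R]_(x in `[c - s, c + s]) k c x.
  have le : c - s <= c + s by lra.
  have -> : 2 = \int[@lebesgue_measure R]_(x in `[c - s, c + s]) (s^-1).
    rewrite Rintegral_cst//= lebesgue_measure_itv /= lte_fin.
    have -> : c - s < c + s by lra.
    by rewrite /=; field; rewrite gt_eqF.
  apply: le_Rintegral => //.
  - apply: continuous_compact_integrable; first exact: segment_compact.
    by move=> ?; exact: cvg_cst.
  - apply: continuous_compact_integrable; first exact: segment_compact.
    by apply: continuous_subspaceT; exact: ck.
  - move=> x /=; rewrite in_itv /= => /andP[x1 x2].
    rewrite /k ler_pdivlMr; last by rewrite ltr_wpDl ?sqr_ge0// exprn_gt0.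
    rewrite ler_pdivrMl//.
    have : 0 <= (s - (x - c)) * (s + (x - c)) by apply: mulr_ge0; lra.
    nra.
rewrite /kappa /sqint /rectint -(segintB q1 q2) -(segintB q3 q4).
rewrite (@eq_segint _ _ _ _ (fun x => 'i * (k (complex.Re z0) x)%:C)); last first.
  move=> x _; case: z0 {cq q1 q2 q3 q4} => c1 c2 /=.
  have -> : x +i* (c2 - s) - c1 +i* c2 = (x - c1) +i* (- s) by complex_ring.
  have -> : x +i* (c2 + s) - c1 +i* c2 = (x - c1) +i* s by complex_ring.
  rewrite /k.
  rewrite !invc_def sqrrN; apply/eqP; rewrite eq_complex /=.
  by apply/andP; split; apply/eqP; field; rewrite gt_eqF// ltr_wpDl ?sqr_ge0// exprn_gt0.
rewrite (@eq_segint _ (complex.Im z0 - _) _ _ (fun x => 1 * (k (complex.Im z0) x)%:C)); last first.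
  move=> x _; case: z0 {cq q1 q2 q3 q4} => c1 c2 /=.
  have -> : (c1 + s) +i* x - c1 +i* c2 = s +i* (x - c2) by complex_ring.
  have -> : (c1 - s) +i* x - c1 +i* c2 = (- s) +i* (x - c2) by complex_ring.
  rewrite /k.
  rewrite !invc_def sqrrN; apply/eqP; rewrite eq_complex /=.
  by apply/andP; split; apply/eqP; field; rewrite gt_eqF// ltr_wpDl ?sqr_ge0// exprn_gt0.
have ckc c a b : ccont a b (fun x => (k c x)%:C).
  by move=> x _; split; [exact: ck|exact: cvg_cst].
rewrite !segintZ// mul1r -mulrDr normcM normc_i mul1r.
apply: le_trans (normc_Re _); apply: le_trans (ler_norm _).
have /= := lk (complex.Re z0); have /= := lk (complex.Im z0).
rewrite /segint /=; lra.
Qed.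

End Cauchy.

(** * Cauchy's formula and a Taylor estimate on squares *)

Local Arguments sqint : simpl never.

Section CauchyFormula.
Variable R : realType.
Notation C := R[i].
Implicit Types (a b c d x y s r : R) (q g : C -> C) (z t : C).

Lemma sqint_hole z0 s z1 r q : 0 <= r ->
  `|complex.Re (z1 - z0)| + r <= s -> `|complex.Im (z1 - z0)| + r <= s ->
  (forall z, onsq z0 s z -> ~~ insq z1 r z -> differentiable q z) ->
  sqint z0 s q = sqint z1 r q.
Proof.
move=> r0; rewrite !raddfB /= => h1 h2 H.
have := ler_norm (complex.Re z1 - complex.Re z0).
have := ler_norm (complex.Im z1 - complex.Im z0).
have := ler_norm (- (complex.Re z1 - complex.Re z0)); rewrite normrN.
have := ler_norm (- (complex.Im z1 - complex.Im z0)); rewrite normrN.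
move=> i1 i2 i3 i4.
apply: rectint_hole; try lra.
move=> z; rewrite onsqE => hz hn; apply: H => //.
by apply: contra hn; rewrite /insq !raddfB /= !ltr_norml => hn; lra.
Qed.

Lemma insq_cont q z0 s t : insq z0 s t ->
  (forall z, z != t -> {for z, continuous q}) ->
  forall z, onsq z0 s z -> ~~ insq z0 s z -> {for z, continuous q}.
Proof. by move=> ht H z _ hz; apply: H; exact: notin_neq ht hz. Qed.

Lemma inv_cont t z : z != t -> {for z, continuous (fun w : C => (w - t)^-1)}.
Proof. by move=> zt; exact/differentiable_continuous/diff_inv. Qed.

(** The difference of the two integrands is O(1 / |z|^2), while the perimeter of a
square of size r is O(r).  Enlarging the square does not change the integral, so
it vanishes. *)
Lemma kappa_eq z0 s t : 0 < s -> insq z0 s t ->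
  sqint z0 s (fun z => (z - t)^-1) = kappa z0 s.
Proof.
move=> s0 ht; have s0' := ltW s0.
have h0 := insq_center z0 s0.
apply/eqP; rewrite -subr_eq0 -normc_eq0 eq_le normc_ge0 andbT.
rewrite -(sqint_B s0' (insq_cont ht (@inv_cont t)) (insq_cont h0 (@inv_cont z0))).
set h := fun z => _; set T := normc (t - z0).
have T0 : 0 <= T := normc_ge0 _.
apply/ler_addgt0Pr => e e0; rewrite add0r.
(* r >= 2 T keeps the large square away from t; r >= 32 T / e makes the bound
   smaller than e. *)
pose r := s + 2 * T + 32 * T / e.
have Te0 : 0 <= 32 * T / e by rewrite divr_ge0 ?mulr_ge0// ltW.
have sr : s <= r by rewrite /r; lra.
have r0 : 0 < r by lra.
have tr : insq z0 r t.
  by case/andP: ht => t1 t2; rewrite /insq (lt_le_trans t1)//= (lt_le_trans t2).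
have dh z : z != t -> z != z0 -> differentiable h z.
  by move=> zt z0'; apply: differentiableB; exact: diff_inv.
have -> : sqint z0 s h = sqint z0 r h.
  symmetry; apply: (sqint_hole s0'); [by rewrite subrr normr0 add0r
    |by rewrite subrr normr0 add0r|move=> z _ hn].
  by apply: dh; [exact: notin_neq ht hn|exact: notin_neq h0 hn].
have hc z : onsq z0 r z -> ~~ insq z0 r z -> {for z, continuous h}.
  move=> _ hn; apply/differentiable_continuous/dh; apply: notin_neq hn => //.
  exact: insq_center.
have hb z : onsq z0 r z -> ~~ insq z0 r z -> normc (h z) <= T * (2 / r ^+ 2).
  move=> _ hn; have zt := notin_neq tr hn.
  have zz := notin_neq (insq_center z0 r0) hn.
  have n1 := notinsq_normc hn.
  have n2 : r / 2 <= normc (z - t).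
    have -> : z - t = (z - z0) - (t - z0) by ring.
    have : normc (z - z0) <= normc (z - z0 - (t - z0)) + normc (t - z0).
      by apply: le_trans (le_normcD _ _); rewrite subrK.
    by rewrite -/T; rewrite /r in n1 *; lra.
  have -> : h z = (t - z0) * ((z - t)^-1 * (z - z0)^-1).
    by rewrite /h; field; rewrite !subr_eq0 zt zz.
  rewrite !normcM !normcV -/T ler_wpM2l//.
  have -> : 2 / r ^+ 2 = (r / 2)^-1 * r^-1 by field; rewrite gt_eqF.
  by apply: ler_pM; rewrite ?invr_ge0 ?normc_ge0// lef_pV2// ?posrE//; lra.
apply: le_trans (sqint_bound (ltW r0) hc hb) _.
have -> : 16 * (T * (2 / r ^+ 2)) * r = 32 * T / r by field; rewrite gt_eqF.
rewrite ler_pdivrMr// [e * r]mulrC -ler_pdivrMr//.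
by rewrite /r; lra.
Qed.

(** The quotient (g(z) - g(t)) / (z - t) is bounded near t because g is
differentiable there.  Its integral equals that over an arbitrarily small square
around t, hence is zero. *)
Lemma cauchy_formula z0 s g t : 0 < s -> insq z0 s t ->
  (forall z, onsq z0 s z -> differentiable g z) ->
  sqint z0 s (fun z => g z * (z - t)^-1) = g t * kappa z0 s.
Proof.
move=> s0 ht dg; have s0' := ltW s0.
(* Where z = t the convention x / 0 = 0 gives q the harmless value 0. *)
pose q (z : C) := (g z - g t) / (z - t).
have dq z : onsq z0 s z -> z != t -> differentiable q z.
  by move=> hz zt; apply: diff_quot => //; exact: dg.
have qc z : onsq z0 s z -> ~~ insq z0 s z -> {for z, continuous q}.
  move=> hz hn; apply/differentiable_continuous/dq => //.
  exact: notin_neq hn.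
have tc z : onsq z0 s z -> ~~ insq z0 s z ->
    {for z, continuous (fun w : C => (w - t)^-1)}.
  by apply: (insq_cont ht) => w; exact: inv_cont.
have gc z : onsq z0 s z -> ~~ insq z0 s z ->
    {for z, continuous (fun w : C => g w * (w - t)^-1)}.
  move=> hz hn; apply: differentiable_continuous; apply: differentiableM.
    exact: dg.
  by apply: diff_inv; exact: notin_neq hn.
have gtc z : onsq z0 s z -> ~~ insq z0 s z ->
    {for z, continuous (fun w : C => g t * (w - t)^-1)}.
  move=> hz hn; apply: differentiable_continuous; apply: differentiableM.
    exact: differentiable_cst.
  by apply: diff_inv; exact: notin_neq hn.
suff q0 : sqint z0 s q = 0.
  apply/eqP; rewrite -subr_eq0 -(kappa_eq s0 ht) -(sqint_Z _ s0' tc) -(sqint_B s0' gc gtc).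
  rewrite -q0; apply/eqP; apply: (eq_sqint s0') => z hz hn.
  by rewrite /q; ring.
apply/eqP; rewrite -normc_eq0 eq_le normc_ge0 andbT leNgt; apply/negP => N0.
set N := normc _ in N0.
have ont : onsq z0 s t by case/andP: ht => t1 t2; rewrite /onsq !ltW.
have [L HL] := diff_eps1 (dg t ont).
have [d d0 Hd] := HL 1 ltr01.
pose M := normc L + 1.
have M0 : 0 < M by rewrite ltr_wpDl// normc_ge0.
move: (ht) => /andP[t1 t2].
pose r := Num.min (Num.min (s - `|complex.Re (t - z0)|)
  (s - `|complex.Im (t - z0)|)) (Num.min (d / 3) (N / (32 * M))).
have r0 : 0 < r.
  by rewrite /r !lt_min !subr_gt0 t1 t2 !divr_gt0// mulr_gt0.
have [r1 r2 r3 r4] : [/\ r <= s - `|complex.Re (t - z0)|,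
    r <= s - `|complex.Im (t - z0)|, r <= d / 3 & r <= N / (32 * M)].
  by rewrite /r; split; rewrite !ge_min lexx ?orbT.
have Jr : sqint z0 s q = sqint t r q.
  apply: (sqint_hole (ltW r0)); [lra|lra|move=> z hz hn].
  by apply: (dq _ hz); exact: notin_neq (insq_center t r0) hn.
have sub z : onsq t r z -> onsq z0 s z.
  rewrite /onsq => /andP[z1 z2].
  have -> : z - z0 = (z - t) + (t - z0) by ring.
  have reD (u v : C) : `|complex.Re (u + v)| <= `|complex.Re u| + `|complex.Re v|.
    by rewrite raddfD; exact: ler_normD.
  have imD (u v : C) : `|complex.Im (u + v)| <= `|complex.Im u| + `|complex.Im v|.
    by rewrite raddfD; exact: ler_normD.
  apply/andP; split; [apply: le_trans (reD _ _) _|apply: le_trans (imD _ _) _].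
    by apply: le_trans (lerD z1 (lexx _)) _; lra.
  by apply: le_trans (lerD z2 (lexx _)) _; lra.
have rc z : onsq t r z -> ~~ insq t r z -> {for z, continuous q}.
  move=> hz hn; apply/differentiable_continuous/dq; first exact: sub.
  by apply: notin_neq hn; exact: insq_center.
have rb z : onsq t r z -> ~~ insq t r z -> normc (q z) <= M.
  move=> hz hn; have zt := notin_neq (insq_center t r0) hn.
  have nz : normc (z - t) < d.
    apply: le_lt_trans (normc_le_ReIm _) _; case/andP: hz => z1 z2.
    apply: le_lt_trans (lerD z1 z2) _; lra.
  have n0 : 0 < normc (z - t) by rewrite normc_gt0 subr_eq0.
  rewrite /q normcM normcV ler_pdivrMr// /M mulrDl mul1r -normcM.
  have := le_normcD (g z - g t - L * (z - t)) (L * (z - t)); rewrite subrK.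
  have := Hd _ nz; rewrite mul1r; lra.
have := sqint_bound (ltW r0) rc rb; rewrite -Jr -/N => NB.
have : 16 * M * r <= N / 2.
  apply: le_trans (ler_wpM2l _ r4) _; first by rewrite mulr_ge0// ltW.
  by rewrite le_eqVlt; apply/orP; left; apply/eqP; field; rewrite gt_eqF.
lra.
Qed.

(** Subtract Cauchy's formulas at t and z0 and the formula that defines L: the
kernels combine into (t - z0)^2 / ((z - z0)^2 (z - t)), which is
O(|t - z0|^2 / s^3) on the boundary.  The derivative at z0 is L, but it is only
given through the estimate, which determines it. *)
Lemma taylor_estimate z0 s g (M : R) : 0 < s ->
  (forall z, onsq z0 s z -> differentiable g z) ->
  (forall z, onsq z0 s z -> normc (g z) <= M) ->
  exists2 L : C, normc L <= 4 * M / s &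
    forall t, normc (t - z0) <= s / 2 ->
      normc (g t - g z0 - L * (t - z0)) <= 8 * M / s ^+ 2 * normc (t - z0) ^+ 2.
Proof.
move=> s0 dg gM; have s0' := ltW s0.
have k4 := kappa_ge4 z0 s0.
have k0 : kappa z0 s != 0 by rewrite -normc_gt0; lra.
have h0 := insq_center z0 s0.
have M0 : 0 <= M.
  by apply: le_trans (normc_ge0 _) (gM z0 _); case/andP: h0 => t1 t2; rewrite /onsq !ltW.
have gi (t z : C) (q : C -> C) : insq z0 s t -> onsq z0 s z -> ~~ insq z0 s z ->
    differentiable q z ->
    differentiable (fun w : C => q w * (w - t)^-1) z.
  move=> ht hz hn dq; apply: differentiableM; first exact: dq.
  by apply: diff_inv; exact: notin_neq ht hn.
pose q2 (z : C) := g z * (z - z0)^-1 * (z - z0)^-1.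
have cq2 z : onsq z0 s z -> ~~ insq z0 s z -> {for z, continuous q2}.
  move=> hz hn; apply: differentiable_continuous; apply: (gi) => //.
  by apply: gi => //; exact: dg.
have divk (A : C) (B : R) : normc A <= B -> normc ((kappa z0 s)^-1 * A) <= B / 4.
  move=> AB; rewrite normcM normcV mulrC.
  have k4' : 0 < normc (kappa z0 s) by lra.
  apply: ler_pM => //; rewrite ?normc_ge0 ?invr_ge0 ?normc_ge0//.
  by rewrite lef_pV2 ?posrE.
exists ((kappa z0 s)^-1 * sqint z0 s q2).
  have -> : 4 * M / s = (16 * (M / s ^+ 2) * s) / 4 by field; rewrite gt_eqF.
  apply: divk; apply: (sqint_bound s0' cq2) => z hz hn.
  have nz := notinsq_normc hn.
  rewrite !normcM !normcV -mulrA expr2 invfM.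
  apply: ler_pM; rewrite ?normc_ge0 ?mulr_ge0 ?invr_ge0 ?normc_ge0 ?gM//.
  by apply: ler_pM; rewrite ?invr_ge0 ?normc_ge0// lef_pV2 ?posrE//; lra.
move=> t ts.
have ht : insq z0 s t.
  by rewrite /insq (le_lt_trans (normc_Re _)) ?(le_lt_trans (normc_Im _))//; lra.
pose gt (z : C) := g z * (z - t)^-1.
pose g1 (z : C) := g z * (z - z0)^-1.
have c1 z : onsq z0 s z -> ~~ insq z0 s z -> {for z, continuous gt}.
  by move=> hz hn; apply: differentiable_continuous; apply: gi => //; exact: dg.
have c2 z : onsq z0 s z -> ~~ insq z0 s z -> {for z, continuous g1}.
  by move=> hz hn; apply: differentiable_continuous; apply: gi => //; exact: dg.
have c3 z : onsq z0 s z -> ~~ insq z0 s z -> {for z, continuous (fun w => gt w - g1 w)}.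
  by move=> hz hn; apply: contB; [exact: c1|exact: c2].
have c4 z : onsq z0 s z -> ~~ insq z0 s z ->
    {for z, continuous (fun w => (t - z0) * q2 w)}.
  move=> hz hn; apply: differentiable_continuous; apply: differentiableM.
    exact: differentiable_cst.
  by apply: (gi) => //; apply: gi => //; exact: dg.
have E : g t - g z0 - (kappa z0 s)^-1 * sqint z0 s q2 * (t - z0) =
    (kappa z0 s)^-1 * sqint z0 s (fun z => gt z - g1 z - (t - z0) * q2 z).
  rewrite (sqint_B s0' c3 c4) (sqint_B s0' c1 c2) (sqint_Z _ s0' cq2).
  by rewrite (cauchy_formula s0 ht dg) (cauchy_formula s0 h0 dg); field.
rewrite E.
have c5 z : onsq z0 s z -> ~~ insq z0 s z ->
    {for z, continuous (fun w => gt w - g1 w - (t - z0) * q2 w)}.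
  by move=> hz hn; apply: contB; [exact: c3|exact: c4].
set T := normc (t - z0).
have -> : 8 * M / s ^+ 2 * T ^+ 2 =
    16 * (M * (T ^+ 2 * (s^-1 * s^-1 * (s / 2)^-1))) * s / 4.
  by field; rewrite gt_eqF.
apply: divk; apply: (sqint_bound s0' c5) => z hz hn.
have nz := notinsq_normc hn.
have zt := notin_neq ht hn; have zz := notin_neq h0 hn.
have -> : gt z - g1 z - (t - z0) * q2 z =
   g z * ((t - z0) ^+ 2 * ((z - z0)^-1 * (z - z0)^-1 * (z - t)^-1)).
  by rewrite /gt /g1 /q2; field; rewrite !subr_eq0 zt zz.
have n2 : s / 2 <= normc (z - t).
  have -> : z - t = (z - z0) - (t - z0) by ring.
  have : normc (z - z0) <= normc (z - z0 - (t - z0)) + normc (t - z0).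
    by apply: le_trans (le_normcD _ _); rewrite subrK.
  by lra.
have iv (u v : R) : 0 < u -> u <= v -> v^-1 <= u^-1.
  by move=> u0 uv; rewrite lef_pV2 ?posrE//; lra.
have i1 := iv _ _ s0 nz.
have i2 := iv _ _ (divr_gt0 s0 (ltr0n _ 2)) n2.
rewrite expr2 !normcM !normcV -/T -expr2.
apply: ler_pM; rewrite ?normc_ge0 ?gM//.
  by rewrite !mulr_ge0 ?sqr_ge0 ?invr_ge0 ?normc_ge0.
rewrite ler_wpM2l ?sqr_ge0//.
apply: ler_pM; rewrite ?mulr_ge0 ?invr_ge0 ?normc_ge0//.
by apply: ler_pM; rewrite ?invr_ge0 ?normc_ge0.
Qed.

End CauchyFormula.

(** * The sub-mean value inequality on a square *)

Section PlaneSubmean.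
Variable R : realType.
Notation C := R[i].
Notation mu := (@lebesgue_measure R).
Implicit Types (a b c d x y s r : R) (q g : C -> C) (z t : C).

Lemma normc_cont (f : R -> C) a b : ccont a b f ->
  forall x, x \in `[a, b] -> {for x, continuous (fun y => normc (f y))}.
Proof.
move=> cf x xab; have [c1 c2] := cf x xab.
rewrite (_ : (fun y => _) = (@Num.sqrt R) \o
  (fun y => complex.Re (f y) ^+ 2 + complex.Im (f y) ^+ 2)); last first.
  by apply/funext => y /=; case: (f y).
apply: continuous_comp; last exact: sqrt_continuous.
by apply: cvgD; apply: cvgM.
Qed.

Lemma normc_int (f : R -> C) a b : ccont a b f ->
  mu.-integrable `[a, b] (EFin \o (fun y => normc (f y))).
Proof.
move=> cf; apply: continuous_compact_integrable; first exact: segment_compact.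
by apply: continuous_in_subspaceT => x /set_mem xab; exact: (normc_cont cf).
Qed.

Lemma normc_segint (f : R -> C) a b : ccont a b f ->
  normc (segint a b f) <= 2 * \int[mu]_(x in `[a, b]) normc (f x).
Proof.
move=> cf; have [f1 f2] := ccont_int cf; have nf := normc_int cf.
rewrite (le_trans (normc_le_ReIm _))//= mulr_natl mulr2n.
apply: lerD; apply: le_trans (le_normr_Rintegral _ _) _ => //;
  apply: le_Rintegral => //; try exact: (integrable_norm f1);
  try exact: (integrable_norm f2); move=> x _ /=;
  [exact: normc_Re|exact: normc_Im].
Qed.

Lemma side_bound (f : R -> C) (p : R -> C) a b a' b' (r : R) (z0 : C) :
  0 < r -> a <= a' -> b' <= b ->
  ccont a b f -> ccont a' b' (fun x => f x * (p x - z0)^-1) ->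
  (forall x, x \in `[a', b'] -> r <= normc (p x - z0)) ->
  normc (segint a' b' (fun x => f x * (p x - z0)^-1)) <=
  2 / r * \int[mu]_(x in `[a, b]) normc (f x).
Proof.
move=> r0 aa bb cf cq pr.
have cf' := ccont_sub aa bb cf.
apply: le_trans (normc_segint cq) _.
rewrite -mulrA ler_pM2l//.
apply: (@le_trans _ _ (\int[mu]_(x in `[a', b']) (r^-1 * normc (f x)))).
  apply: le_Rintegral => //.
  - exact: normc_int cq.
  - exact: (integrableZl _ _ (normc_int cf')).
  - move=> x xab; rewrite normcM normcV mulrC ler_wpM2r ?normc_ge0//.
    by rewrite lef_pV2 ?posrE ?(lt_le_trans r0) ?pr.
rewrite RintegralZl//; last exact: normc_int.
rewrite ler_pM2l ?invr_gt0//.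
apply: fine_le; try exact: integrable_fin_num (normc_int _).
apply: ge0_subset_integral => //.
- have /integrableP[+ _] := normc_int cf; exact.
- by move=> x _; rewrite lee_fin normc_ge0.
- by move=> x /=; rewrite !in_itv /= => /andP[x1 x2]; rewrite (le_trans aa)//= (le_trans x2).
Qed.

(** Cauchy's formula at the centre, over a rectangle whose four sides move
independently between the squares of half-sides s / 2 and s.  The sides are then
extended to full length, so that each integral depends on one coordinate only. *)
Lemma four_sides (x0 y0 s : R) g : 0 < s ->
  (forall z, onsq (x0 +i* y0) s z -> differentiable g z) ->
  forall x1 x2 y1 y2, x1 \in `[x0 - s, x0 - s / 2] ->
    x2 \in `[x0 + s / 2, x0 + s] -> y1 \in `[y0 - s, y0 - s / 2] ->
    y2 \in `[y0 + s / 2, y0 + s] ->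
  normc (g (x0 +i* y0)) * s <=
    \int[mu]_(x in `[x0 - s, x0 + s]) normc (g (x +i* y1)) +
    \int[mu]_(x in `[x0 - s, x0 + s]) normc (g (x +i* y2)) +
    (\int[mu]_(y in `[y0 - s, y0 + s]) normc (g (x2 +i* y)) +
     \int[mu]_(y in `[y0 - s, y0 + s]) normc (g (x1 +i* y))).
Proof.
move=> s0 dg x1 x2 y1 y2; rewrite !in_itv /= => hx1 hx2 hy1 hy2.
set z0 := x0 +i* y0.
have onsqP x y : x0 - s <= x <= x0 + s -> y0 - s <= y <= y0 + s -> onsq z0 s (x +i* y).
  by move=> hx hy; rewrite -onsqE /onrect /= hx hy.
have cgh y : y0 - s <= y <= y0 + s -> ccont (x0 - s) (x0 + s) (fun x => g (x +i* y)).
  move=> hy; apply: ccont_h => x; rewrite in_itv /= => hx.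
  by apply/differentiable_continuous/dg/onsqP.
have cgv x : x0 - s <= x <= x0 + s -> ccont (y0 - s) (y0 + s) (fun y => g (x +i* y)).
  move=> hy; apply: ccont_v => y; rewrite in_itv /= => hx.
  by apply/differentiable_continuous/dg/onsqP.
pose q (z : C) := g z * (z - z0)^-1.
have dq z : onsq z0 s z -> ~~ insq z0 (s / 2) z -> differentiable q z.
  move=> hz hn; apply: differentiableM; first exact: dg.
  by apply: diff_inv; apply: notin_neq hn; apply: insq_center; rewrite divr_gt0.
have s20 : 0 < s / 2 by rewrite divr_gt0.
have hole : rectint x1 x2 y1 y2 q = sqint z0 (s / 2) q.
  apply: rectint_hole => /=; try lra.
  case=> u v /andP[/= hu hv] hn; apply: dq.
    by apply: onsqP; lra.
  by apply: contra hn; rewrite /insq /= !ltr_norml; lra.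
have : normc (g z0) * 4 <= normc (rectint x1 x2 y1 y2 q).
  rewrite hole (cauchy_formula s20 (insq_center z0 s20)).
    by rewrite normcM ler_wpM2l ?normc_ge0// kappa_ge4.
  by move=> z /andP[z1 z2]; apply: dg; rewrite /onsq; lra.
have far x y : ~~ insq z0 (s / 2) (x +i* y) -> s / 2 <= normc ((x +i* y) - z0).
  exact: notinsq_normc.
have qc x y : x0 - s <= x <= x0 + s -> y0 - s <= y <= y0 + s ->
    ~~ insq z0 (s / 2) (x +i* y) -> {for x +i* y, continuous q}.
  by move=> hx hy hn; apply/differentiable_continuous/dq => //; exact: onsqP.
have nin_y x y : (y <= y0 - s / 2) || (y0 + s / 2 <= y) -> ~~ insq z0 (s / 2) (x +i* y).
  by move=> hy; rewrite /insq negb_and /= -!leNgt !ler_normr; lra.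
have nin_x x y : (x <= x0 - s / 2) || (x0 + s / 2 <= x) -> ~~ insq z0 (s / 2) (x +i* y).
  by move=> hy; rewrite /insq negb_and /= -!leNgt !ler_normr; lra.
have Hh y : y0 - s <= y <= y0 + s -> (y <= y0 - s / 2) || (y0 + s / 2 <= y) ->
    normc (segint x1 x2 (fun x => q (x +i* y))) <=
    2 / (s / 2) * \int[mu]_(x in `[x0 - s, x0 + s]) normc (g (x +i* y)).
  move=> hy hy'.
  apply: (@side_bound (fun x => g (x +i* y)) (fun x => x +i* y) (x0 - s)
    (x0 + s) x1 x2 (s / 2) z0 s20); [lra|lra|exact: cgh| |].
  - by apply: (@ccont_h _ q) => x; rewrite in_itv /= => hx; apply: qc; [lra|lra|exact: nin_y].
  - by move=> x _ /=; exact: (far _ _ (nin_y _ _ hy')).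
have Hv x : x0 - s <= x <= x0 + s -> (x <= x0 - s / 2) || (x0 + s / 2 <= x) ->
    normc (segint y1 y2 (fun y => q (x +i* y))) <=
    2 / (s / 2) * \int[mu]_(y in `[y0 - s, y0 + s]) normc (g (x +i* y)).
  move=> hx hx'.
  apply: (@side_bound (fun y => g (x +i* y)) (fun y => x +i* y) (y0 - s)
    (y0 + s) y1 y2 (s / 2) z0 s20); [lra|lra|exact: cgv| |].
  - by apply: (@ccont_v _ q) => y; rewrite in_itv /= => hy; apply: qc; [lra|lra|exact: nin_x].
  - by move=> y _ /=; exact: (far _ _ (nin_x _ _ hx')).
have B1 := Hh y1 ltac:(lra) ltac:(lra).
have B2 := Hh y2 ltac:(lra) ltac:(lra).
have B3 := Hv x2 ltac:(lra) ltac:(lra).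
have B4 := Hv x1 ltac:(lra) ltac:(lra).
have T : normc (rectint x1 x2 y1 y2 q) <=
  normc (segint x1 x2 (fun x => q (x +i* y1))) +
  normc (segint x1 x2 (fun x => q (x +i* y2))) +
 (normc (segint y1 y2 (fun y => q (x2 +i* y))) +
  normc (segint y1 y2 (fun y => q (x1 +i* y)))).
  apply: le_trans (le_normcD _ _) _; rewrite normcM normc_i mul1r.
  exact: lerD (le_normcB _ _) (le_normcB _ _).
move=> H; rewrite -ler_pdivlMr//.
have e4 : 2 / (s / 2) = 4 * s^-1 by field; rewrite gt_eqF.
rewrite e4 in B1 B2 B3 B4.
have := le_trans H (le_trans T (lerD (lerD B1 B2) (lerD B3 B4))).
move: (\int[mu]_(x in `[x0 - s, x0 + s]) _) (\int[mu]_(x in `[x0 - s, x0 + s]) _).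
move=> I1 I2.
move: (\int[mu]_(x in `[y0 - s, y0 + s]) _) (\int[mu]_(x in `[y0 - s, y0 + s]) _).
move=> I3 I4; move: (s^-1) (normc _) => w N; clear; lra.
Qed.

Local Open Scope ereal_scope.

(** In [four_sides] the four positions are independent, so one of the four families
of side integrals is bounded below at all its positions: otherwise choose a bad
position for each.  Integrating that family over its strip gives the area
integral.  The majorant H carries the measurability, which g alone would only
have on the square. *)
Lemma plane_submean (x0 y0 s : R) g (H : (measurableTypeR R * measurableTypeR R)%type -> \bar R) : (0 < s)%R ->
  (forall z, onsq (x0 +i* y0) s z -> differentiable g z) ->
  measurable_fun setT H ->
  (forall p, 0 <= H p) ->
  (forall x y, (x \in `[x0 - s, x0 + s])%R -> (y \in `[y0 - s, y0 + s])%R ->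
    (normc (g (x +i* y)))%:E <= H (x, y)) ->
  (normc (g (x0 +i* y0)))%:E <=
    (8 / s ^+ 2)%:E * \int[mu]_x \int[mu]_y H (x, y).
Proof.
move=> s0 dg mH H0 gH.
set N := normc (g (x0 +i* y0)).
pose A (y : R) := (\int[mu]_(x in `[x0 - s, x0 + s]) normc (g (x +i* y)))%R.
pose B (x : R) := (\int[mu]_(y in `[y0 - s, y0 + s]) normc (g (x +i* y)))%R.
have F4 := four_sides s0 dg; rewrite -/N in F4.
have onsqP x y : (x \in `[x0 - s, x0 + s] -> y \in `[y0 - s, y0 + s] ->
    onsq (x0 +i* y0) s (x +i* y))%R.
  by rewrite !in_itv /= => hx hy; rewrite -onsqE /onrect /= hx hy.
have AH y : (y \in `[y0 - s, y0 + s])%R -> (A y)%:E <= \int[mu]_x H (x, y).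
  move=> hy.
  have cg : ccont (x0 - s)%R (x0 + s)%R (fun x => g (x +i* y)).
    by apply: ccont_h => x hx; apply/differentiable_continuous/dg/onsqP.
  have ig := normc_int cg.
  rewrite /A /Rintegral fineK; last exact: integrable_fin_num ig.
  have mHy : measurable_fun [set: measurableTypeR R] (fun x => H (x, y)).
    exact: measurable_fun_pair1.
  apply: (@le_trans _ _ (\int[mu]_(x in `[(x0 - s)%R, (x0 + s)%R]) H (x, y))).
    apply: ge0_le_integral => //.
    - by move=> x _; rewrite lee_fin normc_ge0.
    - by have /integrableP[] := ig.
    - exact: measurable_funTS.
    - by move=> x hx; exact: gH.
  by apply: ge0_subset_integral => //.
have BH x : (x \in `[x0 - s, x0 + s])%R -> (B x)%:E <= \int[mu]_y H (x, y).
  move=> hx.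
  have cg : ccont (y0 - s)%R (y0 + s)%R (fun y => g (x +i* y)).
    by apply: ccont_v => y hy; apply/differentiable_continuous/dg/onsqP.
  have ig := normc_int cg.
  rewrite /B /Rintegral fineK; last exact: integrable_fin_num ig.
  have mHx : measurable_fun [set: measurableTypeR R] (fun y => H (x, y)).
    exact: measurable_fun_pair2.
  apply: (@le_trans _ _ (\int[mu]_(y in `[(y0 - s)%R, (y0 + s)%R]) H (x, y))).
    apply: ge0_le_integral => //.
    - by move=> y _; rewrite lee_fin normc_ge0.
    - by have /integrableP[] := ig.
    - exact: measurable_funTS.
    - by move=> y hy; exact: gH.
  by apply: ge0_subset_integral => //.
(* A lower bound N s / 4 on a strip of width s / 2 integrates to N s^2 / 8. *)
have strip (G : R -> \bar R) (a b : R) : (b - a = s / 2)%R ->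
    measurable_fun [set: measurableTypeR R] G -> (forall x, 0 <= G x) ->
    (forall x, (x \in `[a, b])%R -> (N * s / 4)%:E <= G x) ->
    N%:E <= (8 / s ^+ 2)%:E * \int[mu]_x G x.
  move=> ab mG G0 NG.
  have -> : N%:E = (8 / s ^+ 2)%:E * (N * s / 4 * (s / 2))%:E.
    by rewrite -EFinM; congr EFin; field; rewrite gt_eqF.
  apply: lee_wpmul2l; first by rewrite lee_fin divr_ge0// sqr_ge0.
  apply: (@le_trans _ _ (\int[mu]_(x in `[a, b]) G x)); last first.
    exact: ge0_subset_integral.
  have -> : (N * s / 4 * (s / 2))%:E = \int[mu]_(x in `[a, b]) cst (N * s / 4)%:E x.
    rewrite integral_cst//= lebesgue_measure_itv /= lte_fin.
    have -> : (a < b)%R by lra.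
    by rewrite -EFinB -EFinM ab.
  apply: ge0_le_integral => //.
  - by move=> x _; rewrite lee_fin !mulr_ge0 ?normc_ge0// ltW.
  - exact: measurable_funTS.
have mF : measurable_fun [set: measurableTypeR R] (fun x => \int[mu]_y H (x, y)).
  have := @measurable_fun_fubini_tonelli_F _ _ _ _ R mu H mH H0.
  exact.
have mG : measurable_fun [set: measurableTypeR R] (fun y => \int[mu]_x H (x, y)).
  have := @measurable_fun_fubini_tonelli_G _ _ _ _ R mu H mH H0.
  exact.
have F0 x : 0 <= \int[mu]_y H (x, y) by apply: integral_ge0 => y _.
have G0 y : 0 <= \int[mu]_x H (x, y) by apply: integral_ge0 => x _.
have [h1|/existsNP[y1 /not_implyP[hy1 /negP]]] := pselect (forall y, (y \in `[y0 - s, y0 - s / 2] -> N * s / 4 <= A y)%R).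
  rewrite (@fubini_tonelli _ _ _ _ R mu mu H mH H0).
  apply: (@strip _ (y0 - s)%R (y0 - s / 2)%R) => //; first by field.
  move=> y hy; apply: le_trans (AH y _); first by rewrite lee_fin h1.
  by move: hy; rewrite !in_itv /=; lra.
rewrite -ltNge => h1.
have [h2|/existsNP[y2 /not_implyP[hy2 /negP]]] := pselect (forall y, (y \in `[y0 + s / 2, y0 + s] -> N * s / 4 <= A y)%R).
  rewrite (@fubini_tonelli _ _ _ _ R mu mu H mH H0).
  apply: (@strip _ (y0 + s / 2)%R (y0 + s)%R) => //; first by field.
  move=> y hy; apply: le_trans (AH y _); first by rewrite lee_fin h2.
  by move: hy; rewrite !in_itv /=; lra.
rewrite -ltNge => h2.
have [h3|/existsNP[x1 /not_implyP[hx1 /negP]]] := pselect (forall x, (x \in `[x0 - s, x0 - s / 2] -> N * s / 4 <= B x)%R).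
  apply: (@strip _ (x0 - s)%R (x0 - s / 2)%R) => //; first by field.
  move=> x hx; apply: le_trans (BH x _); first by rewrite lee_fin h3.
  by move: hx; rewrite !in_itv /=; lra.
rewrite -ltNge => h3.
apply: (@strip _ (x0 + s / 2)%R (x0 + s)%R) => //; first by field.
move=> x2 hx2; apply: le_trans (BH x2 _); last first.
  by move: hx2; rewrite !in_itv /=; lra.
rewrite lee_fin.
have := F4 x1 x2 y1 y2 hx1 hx2 hy1 hy2; rewrite -/(A y1) -/(A y2) -/(B x1) -/(B x2).
lra.
Qed.

End PlaneSubmean.

(** * Lebesgue measure on C^n and the sub-mean value inequality on boxes *)

Section Volume.
Variable R : realType.
Notation C := R[i].
Notation plane := (measurableTypeR R * measurableTypeR R)%type.
Notation lam := (@lebesgue_measure R).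

(** Lebesgue measure on C^n under a name of its own, to which sigma-finiteness can
be attached as a structure. *)
Definition vol n : set (n.-tuple plane) -> \bar R := lebesgue_Cn R n.

HB.instance Definition _ n := Measure.copy (@vol n) (lebesgue_Cn R n).

Definition tbox n (c : n.-tuple plane) (s : R) : set (n.-tuple plane) :=
  [set t | forall j, `|(tnth t j).1 - (tnth c j).1| <= s /\
                     `|(tnth t j).2 - (tnth c j).2| <= s].

Lemma cvec_itv (x c s : R) : `|x - c| <= s <-> x \in `[c - s, c + s].
Proof. by rewrite in_itv /= ler_distl. Qed.

Lemma measurable_tbox n (c : n.-tuple plane) s : measurable (tbox c s).
Proof.
rewrite (_ : tbox c s = \bigcap_(j in [set: 'I_n])
  ((fun t => tnth t j) @^-1`
    (`[(tnth c j).1 - s, (tnth c j).1 + s] `*`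
     `[(tnth c j).2 - s, (tnth c j).2 + s]))).
  apply: fin_bigcap_measurable => // j _; rewrite -[X in measurable X]setTI.
  by apply: measurable_tnth => //; exact: measurableX.
apply/seteqP; split => t /= H j.
  by move=> _; have [/cvec_itv h1 /cvec_itv h2] := H j; split.
by have [h1 h2] := H j I; split; exact/cvec_itv.
Qed.

Lemma tbox_tcons n (a : plane) (c : n.-tuple plane) s :
  @tcons R n @^-1` tbox [tuple of a :: c] s =
  (tbox c s `*` `[a.1 - s, a.1 + s]) `*` `[a.2 - s, a.2 + s].
Proof.
apply/seteqP; split => [[[t x] y]|[[t x] y]] /=.
  move=> H; split.
    split.
      by move=> j; have := H (lift ord0 j); rewrite /tcons !tnthS.
    by have [/cvec_itv h _] := H ord0; move: h; rewrite /tcons !tnth0.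
  by have [_ /cvec_itv h] := H ord0; move: h; rewrite /tcons !tnth0.
move=> [[H /cvec_itv hx] /cvec_itv hy] j; rewrite /tcons /=.
have [->|[k ->]] : j = ord0 \/ exists k, j = lift ord0 k.
  by case: (unliftP ord0 j) => [k ->|->]; [right; exists k|left].
  by rewrite !tnth0.
by rewrite !tnthS.
Qed.

Lemma tbox_finite n (c : n.-tuple plane) s : 0 <= s -> (vol (tbox c s) < +oo)%E.
Proof.
move=> s0; elim: n c => [|n IH] c.
  rewrite /vol /= diracE; case: (_ \in _); exact: ltry.
rewrite (tuple_eta c).
have -> : vol (tbox [tuple of thead c :: behead_tuple c] s) =
    (((lebesgue_Cn R n) \x lam) \x lam)%E
     (@tcons R n @^-1` tbox [tuple of thead c :: behead_tuple c] s) by [].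
rewrite tbox_tcons.
have mB := measurable_tbox (behead_tuple c) s.
have E1 := @product_measure1E _ _ _ _ R (lebesgue_Cn R n) lam _
  `[(thead c).1 - s, (thead c).1 + s] mB (measurable_itv _).
have E2 := @product_measure1E _ _ _ _ R (lebesgue_Cn R n \x lam)%E lam _
  `[(thead c).2 - s, (thead c).2 + s]
  (measurableX mB (measurable_itv `[(thead c).1 - s, (thead c).1 + s]))
  (measurable_itv _).
rewrite [X in (X < _)%E]E2 [X in (X * _ < _)%E]E1.
have fin (x : R) : lam `[(x - s)%R, (x + s)%R] \is a fin_num.
  by rewrite lebesgue_measure_itv /=; case: ifP.
have finm : lebesgue_Cn R n (tbox (behead_tuple c) s) \is a fin_num.
  by rewrite ge0_fin_numE; [exact: IH|exact: measure_ge0].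
have : (lebesgue_Cn R n (tbox (behead_tuple c) s) *
  lam `[((thead c).1 - s)%R, ((thead c).1 + s)%R] *
  lam `[((thead c).2 - s)%R, ((thead c).2 + s)%R])%E \is a fin_num.
  by rewrite !fin_numM.
by rewrite fin_numElt => /andP[].
Qed.

Lemma vol_sigma_finite n : sigma_finite [set: n.-tuple plane] (@vol n).
Proof.
pose o : n.-tuple plane := [tuple (0, 0) | i < n].
exists (fun k => tbox o k%:R).
  apply/seteqP; split => // t _.
  pose m := \sum_(j < n) (`|(tnth t j).1| + `|(tnth t j).2|).
  have m0 : 0 <= m by apply: sumr_ge0 => j _; rewrite addr_ge0.
  exists (Num.bound m) => // j.
  have mj : `|(tnth t j).1| + `|(tnth t j).2| <= m.
    by rewrite /m (bigD1 j)//= lerDl sumr_ge0// => k _; rewrite addr_ge0.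
  have := ltW (archi_boundP m0); rewrite tnth_mktuple /= !subr0 => mb.
  have := normr_ge0 (tnth t j).1; have := normr_ge0 (tnth t j).2; lra.
by move=> k; split; [exact: measurable_tbox|exact: tbox_finite].
Qed.

HB.instance Definition _ n :=
  @Measure_isSigmaFinite.Build _ _ _ (@vol n) (@vol_sigma_finite n).

(** The stage between n and n + 1 complex coordinates: one more real axis. *)
Definition volx n : set (n.-tuple plane * measurableTypeR R)%type -> \bar R :=
  (@vol n \x lam)%E.

Let volx0 n : volx (n := n) set0 = 0%E.
Proof. exact: (measure0 (@vol n \x lam)%E). Qed.

Let volx_ge0 n A : (0 <= volx (n := n) A)%E.
Proof. exact: (measure_ge0 (@vol n \x lam)%E). Qed.

Let volx_sigma_additive n : semi_sigma_additive (volx (n := n)).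
Proof. exact: (@measure_semi_sigma_additive _ _ _ (@vol n \x lam)%E). Qed.

HB.instance Definition _ n := isMeasure.Build _ _ _ (volx (n := n))
  (@volx0 n) (@volx_ge0 n) (@volx_sigma_additive n).

Lemma volx_sigma_finite n : sigma_finite setT (volx (n := n)).
Proof.
have [F TF Fo] := @vol_sigma_finite n.
exists (fun k => (\big[setU/set0]_(i < k) F i) `*` `[- k%:R, k%:R]).
  apply/seteqP; split => // -[t x] _.
  have [i _ Fi] : (\bigcup_i F i) t by rewrite -TF.
  exists (maxn i.+1 (Num.bound `|x|)) => //; split => /=.
    by rewrite -bigcup_mkord; exists i => //=; rewrite leq_max leqnn.
  rewrite in_itv /= -ler_norml (le_trans (ltW (archi_boundP _)))//.
  by rewrite ler_nat leq_max leqnn orbT.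
move=> k.
have mF : measurable (\big[setU/set0]_(i < k) F i).
  by apply: bigsetU_measurable => i _; have [] := Fo i.
split; first exact: measurableX.
rewrite /volx (@product_measure1E _ _ _ _ R (@vol n) lam)//.
have : (vol (\big[setU/set0]_(i < k) F i) * lam `[(- k%:R)%R, k%:R%R])%E \is a fin_num.
  rewrite fin_numM//; last by rewrite lebesgue_measure_itv /=; case: ifP.
  rewrite ge0_fin_numE ?measure_ge0//.
  apply: (@le_lt_trans _ _ (\sum_(i < k) vol (F i))%E).
    by apply: Boole_inequality => // i _; have [] := Fo i.
  by apply: lte_sum_pinfty => i _; have [] := Fo i.
by rewrite fin_numElt => /andP[].
Qed.

HB.instance Definition _ n :=
  @Measure_isSigmaFinite.Build _ _ _ (volx (n := n)) (@volx_sigma_finite n).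

(** Tonelli's theorem for the last step in the construction of the measure. *)
Lemma integral_volS n (f : n.+1.-tuple plane -> \bar R) :
  measurable_fun setT f -> (forall t, 0 <= f t)%E ->
  (\int[@vol n.+1]_t f t = \int[@vol n]_t \int[lam]_x \int[lam]_y f [tuple of (x, y) :: t])%E.
Proof.
move=> mf f0.
have mt := @measurable_tcons R n.
have -> : (\int[@vol n.+1]_t f t = \int[pushforward (volx (n := n) \x lam) (@tcons R n)]_(t in setT) f t)%E by [].
rewrite (ge0_integral_pushforward mt) => [|//|//|t _]; last exact: f0.
rewrite preimage_setT.
have mft : measurable_fun setT (f \o @tcons R n) by exact: measurableT_comp.
rewrite (@fubini_tonelli1 _ _ _ _ R (volx (n := n)) lam (f \o @tcons R n) mft); last first.
  by move=> p; exact: f0.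
have mF := @measurable_fun_fubini_tonelli_F _ _ _ _ R lam (f \o @tcons R n) mft (fun p => f0 _).
rewrite (@fubini_tonelli1 _ _ _ _ R (@vol n) lam _ mF)//.
by move=> p; apply: integral_ge0 => y _; exact: f0.
Qed.

Lemma measurable_volS n (f : n.+1.-tuple plane -> \bar R) :
  measurable_fun setT f -> (forall t, 0 <= f t)%E ->
  measurable_fun setT (fun t : n.-tuple plane =>
    (\int[lam]_x \int[lam]_y f [tuple of (x, y) :: t])%E).
Proof.
move=> mf f0.
have mft : measurable_fun setT (f \o @tcons R n).
  by apply: measurableT_comp => //; exact: measurable_tcons.
have mF := @measurable_fun_fubini_tonelli_F _ _ _ _ R lam (f \o @tcons R n) mft (fun p => f0 _).
have := @measurable_fun_fubini_tonelli_F _ _ _ _ R lam _ mF.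
by apply; move=> p; apply: integral_ge0 => y _; exact: f0.
Qed.

Definition upd n (t : n.-tuple plane) (j : 'I_n) (z : C) : n.-tuple plane :=
  [tuple if i == j then (complex.Re z, complex.Im z) else tnth t i | i < n].

Lemma upd0 n (a : plane) (t : n.-tuple plane) (z : C) :
  upd [tuple of a :: t] ord0 z =
  [tuple of (complex.Re z : measurableTypeR R, complex.Im z : measurableTypeR R) :: t].
Proof.
apply: eq_from_tnth => j; rewrite tnth_mktuple.
by case: (unliftP ord0 j) => [k ->|->]; rewrite ?tnthS ?tnth0//.
Qed.

Lemma updS n (a : plane) (t : n.-tuple plane) j (z : C) :
  upd [tuple of a :: t] (lift ord0 j) z = [tuple of a :: upd t j z].
Proof.
apply: eq_from_tnth => i; rewrite tnth_mktuple.
case: (unliftP ord0 i) => [k ->|->]; rewrite ?tnthS ?tnth0//.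
by rewrite tnth_mktuple (inj_eq lift_inj).
Qed.

Definition cplx (p : plane) : C := p.1 +i* p.2.

(** Freeze all coordinates but the first and use [plane_submean]; then use the
induction hypothesis with the resulting double integral as majorant. *)
Lemma tuple_submean n (c : n.-tuple plane) (s : R)
    (G : n.-tuple plane -> C) (H : n.-tuple plane -> \bar R) : 0 < s ->
  (forall t j, tbox c s t ->
    differentiable (fun z => G (upd t j z)) (cplx (tnth t j))) ->
  measurable_fun setT H -> (forall t, 0 <= H t)%E ->
  (forall t, tbox c s t -> (normc (G t))%:E <= H t)%E ->
  ((normc (G c))%:E <= ((8 / s ^+ 2) ^+ n)%:E * \int[@vol n]_t H t)%E.
Proof.
move=> s0; have K0 : 0 <= 8 / s ^+ 2 by rewrite divr_ge0// sqr_ge0.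
elim: n c G H => [|n IH] c G H dG mH H0 GH.
  rewrite expr0 mul1e.
  have -> : (\int[@vol 0]_t H t = H c)%E.
    have -> : (\int[@vol 0]_t H t =
      \int[\d_([tuple] : 0.-tuple plane)]_(t in setT) H t)%E by [].
    by rewrite integral_dirac//= diracE in_setT mul1e (tuple0 c).
  by apply: GH => -[].
case/tupleP: c dG GH => a c' dG GH.
pose H' (t : n.-tuple plane) := ((8 / s ^+ 2)%:E *
  \int[lam]_x \int[lam]_y H [tuple of (x, y) :: t])%E.
have mH' := measurable_volS mH H0.
have I0 (t : n.-tuple plane) : (0 <= \int[lam]_x \int[lam]_y H [tuple of (x, y) :: t])%E.
  by apply: integral_ge0 => x _; apply: integral_ge0 => y _; exact: H0.
have boxS (p : plane) (t : n.-tuple plane) : `|p.1 - a.1| <= s -> `|p.2 - a.2| <= s -> tbox c' s t ->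
    tbox [tuple of a :: c'] s [tuple of p :: t].
  move=> h1 h2 ht j.
  by case: (unliftP ord0 j) => [k ->|->]; rewrite ?tnthS ?tnth0.
have a_in : `|a.1 - a.1| <= s /\ `|a.2 - a.2| <= s.
  by rewrite !subrr !normr0 ltW.
have key := IH c' (fun t : n.-tuple plane => G [tuple of a :: t]) H'.
apply: le_trans (key _ _ _ _) _.
- move=> t j ht; have := dG [tuple of a :: t] (lift ord0 j) (boxS _ _ a_in.1 a_in.2 ht).
  rewrite tnthS; congr (differentiable _ _).
  by apply/funext => z; rewrite updS.
- exact: measurable_funeM.
- by move=> t; rewrite mule_ge0.
- move=> t ht.
  have := @plane_submean R a.1 a.2 s (fun z => G [tuple of
     (complex.Re z : measurableTypeR R, complex.Im z : measurableTypeR R) :: t])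
     (fun p => H [tuple of p :: t]) s0.
  rewrite -surjective_pairing; apply.
  + move=> z hz.
    have b : tbox [tuple of a :: c'] s [tuple of
      (complex.Re z : measurableTypeR R, complex.Im z : measurableTypeR R) :: t].
      by move: hz; rewrite /onsq !raddfB /= => /andP[h1 h2]; apply: boxS.
    have := dG _ ord0 b; rewrite tnth0 /cplx /=.
    have -> : complex.Re z +i* complex.Im z = z by case: (z).
    congr (differentiable _ _); apply/funext => w; by rewrite upd0.
  + apply: measurableT_comp => //; apply: measurable_cons; first exact: measurable_id.
    exact: measurable_cst.
  + by move=> p; exact: H0.
  + move=> x y /cvec_itv hx /cvec_itv hy; apply: GH; exact: boxS.
rewrite /H' ge0_integralZl//= ?lee_fin//.
by rewrite muleA -EFinM -exprSr integral_volS.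
Qed.

End Volume.

(** * Topology and measurability on C^n *)

Local Notation cpoint := Defs.cpoint.

Section RealNorm.
Variables (R : realType) (n : nat).
Notation C := R[i].
Notation Cn := 'rV[R[i]]_n.
Implicit Types (u v w : Cn).

(** The norm of a vector over R[i] has its values in R[i]; this is the real number
that it is. *)
Definition rnorm v : R := complex.Re `|v|.

Lemma rnormE v : `|v| = (rnorm v)%:C.
Proof.
have := normr_ge0 v; rewrite /rnorm; case: `|v| => a b.
by rewrite lecE /= => /andP[/eqP -> _].
Qed.

Lemma rnorm_ge0 v : 0 <= rnorm v.
Proof. by rewrite -lecR -rnormE; exact: normr_ge0. Qed.

Lemma rnorm_coord v j : normc (v ord0 j) <= rnorm v.
Proof.
rewrite -lecR -rnormE -norm_normc.
have -> : `|v| = mx_norm v by [].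
rewrite mx_normE -[leLHS]nngE num_le.
exact: (le_bigmax _ (fun i : 'I_1 * 'I_n => `|v i.1 i.2|%:nng) (ord0, j)).
Qed.

Lemma rnormZ (a : C) v : rnorm (a *: v) = normc a * rnorm v.
Proof.
have := normrZ a v; rewrite !rnormE norm_normc => h.
by apply: (@complexI R); rewrite rmorphM; exact: h.
Qed.

Lemma rnorm_eq0 v : rnorm v = 0 -> v = 0.
Proof. by move=> h; apply/eqP; rewrite -normr_eq0 rnormE h; exact: eqxx. Qed.

End RealNorm.

Section Points.
Variables (R : realType) (n : nat).
Notation C := R[i].
Notation Cn := 'rV[R[i]]_n.
Notation plane := (measurableTypeR R * measurableTypeR R)%type.

Definition coords (w : Cn) : n.-tuple plane :=
  [tuple (complex.Re (w ord0 j), complex.Im (w ord0 j)) | j < n].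

Lemma coordsK w : cpoint (coords w) = w.
Proof.
apply/rowP => j; rewrite mxE tnth_mktuple /=; by case: (w _ _).
Qed.

Lemma cpointE (t : n.-tuple plane) j : cpoint t ord0 j = cplx (tnth t j).
Proof. by rewrite mxE. Qed.

(** The closed polysquare with centre w and half-side s. *)
Definition cbox (w : Cn) (s : R) : set Cn :=
  [set v | forall j, onsq (w ord0 j) s (v ord0 j)].

Lemma tbox_cbox (w : Cn) s t : tbox (coords w) s t -> cbox w s (cpoint t).
Proof.
move=> H j; rewrite /onsq cpointE /cplx; have := H j.
rewrite tnth_mktuple; case: (w _ _) => a b /= -[h1 h2].
by rewrite h1 h2.
Qed.

Lemma open_cbox (U : set Cn) w : open U -> U w ->
  exists2 s : R, 0 < s & cbox w s `<=` U.
Proof.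
move=> oU Uw; have /nbhs_ballP[e /= /gt0_realc[eE e0] He] := open_nbhs_nbhs (conj oU Uw).
exists (complex.Re e / 3); first by rewrite divr_gt0.
move=> v Hv; apply: He; rewrite eE; split; first by rewrite ltcR.
move=> i j; rewrite (ord1 i) -ball_normE /= norm_normc ltcR distcC.
apply: le_lt_trans (normc_le_ReIm _) _; have /andP[h1 h2] := Hv j.
by apply: le_lt_trans (lerD h1 h2) _; lra.
Qed.

(** An open set is the union of the countably many boxes with rational centres and
half-sides 1 / (k + 1) that it contains. *)
Lemma open_cpoint_measurable (U : set Cn) : open U ->
  measurable (@cpoint R n @^-1` U).
Proof.
move=> oU.
pose rb (q : (n.-tuple (rat * rat) * nat)%type) : set (n.-tuple plane) :=
  tbox [tuple (ratr (tnth q.1 j).1, ratr (tnth q.1 j).2) | j < n] (q.2.+1%:R^-1).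
rewrite (_ : _ @^-1` _ = \bigcup_q (if `[< rb q `<=` @cpoint R n @^-1` U >] then rb q else set0)); last first.
  apply/seteqP; split => t; last first.
    by move=> [q _]; case: ifPn => // /asboolP H /H.
  move=> /= Ut; have [s s0 Hs] := open_cbox oU Ut.
  have [k Hk] : exists k : nat, k.+1%:R^-1 <= s / 2.
    exists (Num.bound (2 / s)); rewrite -[s / 2]invf_div lef_pV2 ?posrE ?divr_gt0//.
    have b := ltW (archi_boundP (ltW (divr_gt0 (ltr0n R 2) s0))).
    by rewrite (le_trans b)// ler_nat.
  have k0 : 0 < k.+1%:R^-1 :> R by rewrite invr_gt0.
  have ratd (d x : R) : 0 < d -> exists q : rat, `|x - ratr q| <= d.
    move=> d0; have xd : x - d < x + d by lra.
    have [q] := rat_in_itvoo xd; rewrite in_itv /= => Hq.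
    by exists q; rewrite ler_norml; lra.
  have /choice[f Hf] : forall x : R, exists q : rat, `|x - ratr q| <= k.+1%:R^-1.
    by move=> x; exact: ratd.
  exists ([tuple (f (tnth t j).1, f (tnth t j).2) | j < n], k) => //.
  case: ifPn => [_|/asboolP[]]; first by move=> j; rewrite !tnth_mktuple /=; split.
  move=> t' Ht'; apply: Hs => j; rewrite !cpointE /onsq /cplx /=.
  have := Ht' j; rewrite !tnth_mktuple /= => -[h1 h2].
  have h3 := Hf (tnth t j).1; have h4 := Hf (tnth t j).2.
  move: Hk h1 h2 h3 h4; move: (k.+1%:R^-1) => d; rewrite !ler_norml => Hd.
  by move=> h1 h2 h3 h4; apply/andP; split; lra.
apply: countable_bigcupT_measurable => // q.
by case: ifP => // _; exact: measurable_tbox.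
Qed.

Lemma cont_measurable (U : set Cn) (phi : Cn -> R) : open U ->
  (forall w, U w -> {for w, continuous phi}) ->
  measurable_fun (@cpoint R n @^-1` U) (fun t => phi (cpoint t)).
Proof.
move=> oU cphi; apply: (measurability _ (RGenOInfty.measurableE R)).
move=> _ [_ [x ->] <-].
rewrite (_ : _ `&` _ = @cpoint R n @^-1` (U `&` [set w | x < phi w])); last first.
  by apply/seteqP; split => t /=; rewrite in_itv /= andbT.
apply: open_cpoint_measurable; rewrite openE => w /= [Uw xw].
apply: filterI; first exact: open_nbhs_nbhs.
have : nbhs (phi w) [set y | x < y].
  by apply: open_nbhs_nbhs; split; [exact: open_gt|exact: xw].
exact: (cphi w Uw).
Qed.

Lemma Re_cont : continuous (fun z : C => complex.Re z).
Proof.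
move=> z A /nbhs_ballP[e /= e0 HA]; apply/nbhs_ballP.
exists e%:C; first by rewrite /= ltcR.
move=> w; rewrite -ball_normE /= norm_normc ltcR => h; apply: HA.
by rewrite -ball_normE /= -raddfB; exact: le_lt_trans (normc_Re _) h.
Qed.

Lemma Im_cont : continuous (fun z : C => complex.Im z).
Proof.
move=> z A /nbhs_ballP[e /= e0 HA]; apply/nbhs_ballP.
exists e%:C; first by rewrite /= ltcR.
move=> w; rewrite -ball_normE /= norm_normc ltcR => h; apply: HA.
by rewrite -ball_normE /= -raddfB; exact: le_lt_trans (normc_Im _) h.
Qed.

Lemma ReIm_cont (f : Cn -> C) w : {for w, continuous f} ->
  {for w, continuous (fun v => complex.Re (f v))} /\
  {for w, continuous (fun v => complex.Im (f v))}.
Proof.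
move=> cf; split.
  by apply: (@continuous_comp _ _ _ f (fun z : C => complex.Re z)) => //; exact: Re_cont.
by apply: (@continuous_comp _ _ _ f (fun z : C => complex.Im z)) => //; exact: Im_cont.
Qed.

Lemma holo_measurable (U : set Cn) (f : Cn -> C) : open U -> holomorphic U f ->
  measurable_fun (@cpoint R n @^-1` U) (fun t => complex.Re (f (cpoint t))) /\
  measurable_fun (@cpoint R n @^-1` U) (fun t => complex.Im (f (cpoint t))).
Proof.
move=> oU hf; split.
  apply: (@cont_measurable U (fun v => complex.Re (f v))) => // w Uw.
  by have [] := ReIm_cont (differentiable_continuous (hf w Uw)).
apply: (@cont_measurable U (fun v => complex.Im (f v))) => // w Uw.
by have [] := ReIm_cont (differentiable_continuous (hf w Uw)).
Qed.

End Points.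

(** * Limits and bounds for holomorphic functions of several variables *)

Section ComplexLimits.
Variable R : realType.
Notation C := R[i].
Implicit Types (u v : nat -> C) (l m : C).

(** Convergence in R[i] with real tolerances. *)
Definition ctends u l := forall e : R, 0 < e ->
  exists N, forall k, (N <= k)%N -> normc (u k - l) < e.

Definition ccauchy u := forall e : R, 0 < e ->
  exists N, forall k j, (N <= k)%N -> (N <= j)%N -> normc (u k - u j) < e.

Lemma ctends_limn u l : ctends u l -> limn u = l.
Proof.
move=> H; apply: cvg_lim => //; move=> A /nbhs_ballP[e /= /gt0_realc[eE e0] HA].
have [N HN] := H _ e0; exists N => // k /= /HN hk; apply: HA.
by rewrite -ball_normE /= norm_normc eE ltcR distcC.
Qed.

Lemma ctends_unique u l m : ctends u l -> ctends u m -> l = m.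
Proof. by move=> /ctends_limn <- /ctends_limn <-. Qed.

Lemma ctends_lin u v l m (a : C) : ctends u l -> ctends v m ->
  ctends (fun k => a * u k + v k) (a * l + m).
Proof.
move=> ul vm e e0.
have d0 : 0 < e / 2 / (normc a + 1) by rewrite !divr_gt0// ltr_wpDl// normc_ge0.
have [N1 H1] := ul _ d0; have [N2 H2] := vm _ (divr_gt0 e0 (ltr0n _ 2)).
exists (maxn N1 N2) => k; rewrite geq_max => /andP[/H1 h1 /H2 h2].
have -> : a * u k + v k - (a * l + m) = a * (u k - l) + (v k - m) by ring.
apply: le_lt_trans (le_normcD _ _) _; rewrite normcM.
have : normc a * normc (u k - l) <= e / 2.
  have := ltW h1; rewrite ler_pdivlMr; last by rewrite ltr_wpDl// normc_ge0.
  by have := normc_ge0 (u k - l); have := normc_ge0 a; nra.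
lra.
Qed.

Lemma ctends_bound u l (B : R) : ctends u l ->
  (forall k, normc (u k) <= B) -> normc l <= B.
Proof.
move=> ul uB; apply/ler_addgt0Pr => e e0; have [N HN] := ul e e0.
have := HN N (leqnn N); have := uB N.
have := le_normcD (u N) (l - u N); rewrite [u N + (l - _)]addrC subrK.
by rewrite (distcC l); lra.
Qed.

Lemma ccauchy_tends u : ccauchy u -> exists l, ctends u l.
Proof.
move=> cu.
have real_lim (r : nat -> R) : (forall k j, `|r k - r j| <= normc (u k - u j)) ->
    exists x, forall e, 0 < e -> exists N, forall k, (N <= k)%N -> `|r k - x| < e.
  move=> rn; have /cauchy_cvgP cr : cauchy (r @ \oo).
    apply: cauchy_exP => e e0; have [N HN] := cu e e0.
    exists (r N); exists N => // k /= Nk; rewrite -ball_normE /=.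
    exact: le_lt_trans (rn _ _) (HN _ _ (leqnn N) Nk).
  exists (limn r) => e e0; have /cvgrPdist_lt/(_ e e0) [N _ HN] := cr.
  by exists N => k Nk; rewrite distrC; exact: HN.
have [x Hx] : exists x, forall e, 0 < e -> exists N, forall k, (N <= k)%N ->
    `|complex.Re (u k) - x| < e.
  by apply: real_lim => k j; rewrite -raddfB; exact: normc_Re.
have [y Hy] : exists x, forall e, 0 < e -> exists N, forall k, (N <= k)%N ->
    `|complex.Im (u k) - x| < e.
  by apply: real_lim => k j; rewrite -raddfB; exact: normc_Im.
exists (x +i* y) => e e0.
have [N1 H1] := Hx _ (divr_gt0 e0 (ltr0n _ 2)).
have [N2 H2] := Hy _ (divr_gt0 e0 (ltr0n _ 2)).
exists (maxn N1 N2) => k; rewrite geq_max => /andP[/H1 h1 /H2 h2].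
apply: le_lt_trans (normc_le_ReIm _) _.
rewrite !raddfB /=; apply: lt_le_trans (ltrD h1 h2) _; lra.
Qed.

End ComplexLimits.

Section SeveralVariables.
Variables (R : realType) (n : nat).
Notation C := R[i].
Notation Cn := 'rV[R[i]]_n.
Notation plane := (measurableTypeR R * measurableTypeR R)%type.
Implicit Types (Omega : set Cn) (f g : Cn -> C) (u v w : Cn).

Definition sqnorm Omega f : \bar R :=
  (\int[@vol R n]_(t in @cpoint R n @^-1` Omega) (normc (f (cpoint t)) ^+ 2)%:E)%E.

Lemma diff_line v u (t : C) : differentiable (fun a : C => v + a *: u) t.
Proof.
apply: differentiableD; first exact: differentiable_cst.
by apply: differentiableZl; exact: differentiable_idC.
Qed.

Lemma measurable_normc2 Omega f : open Omega -> holomorphic Omega f ->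
  measurable_fun (@cpoint R n @^-1` Omega)
    (fun t => (normc (f (cpoint t)) ^+ 2)%:E).
Proof.
move=> oO hf; have [m1 m2] := holo_measurable oO hf.
apply/measurable_EFinP.
rewrite (_ : (fun t => _) = (fun t => complex.Re (f (cpoint t)) ^+ 2 +
   complex.Im (f (cpoint t)) ^+ 2)); last first.
  by apply/funext => t; rewrite normc_sqr.
by apply: measurable_funD; apply: measurable_funX.
Qed.

Lemma cpoint_upd (t : n.-tuple plane) j (z : C) :
  cpoint (upd t j z) = (cpoint t - cplx (tnth t j) *: 'e_j) + z *: 'e_j.
Proof.
apply/rowP => k; rewrite !mxE !tnth_mktuple eqxx /=.
have [->|kj] := eqVneq k j.
  by rewrite !mulr1 subrr add0r /=; case: z.
by rewrite !mulr0 subr0 addr0.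
Qed.

(** The sub-mean value inequality is applied to f^2, which turns an L^1 bound into
an L^2 bound. *)
Lemma eval_bound Omega f w (s : R) : open Omega -> holomorphic Omega f ->
  0 < s -> cbox w s `<=` Omega ->
  ((normc (f w) ^+ 2)%:E <= ((8 / s ^+ 2) ^+ n)%:E * sqnorm Omega f)%E.
Proof.
move=> oO hf s0 wO.
pose D := @cpoint R n @^-1` Omega.
have mD : measurable D := open_cpoint_measurable oO.
pose H := (fun t => (normc (f (cpoint t)) ^+ 2)%:E) \_ D.
have -> : sqnorm Omega f = (\int[@vol R n]_t H t)%E by rewrite /sqnorm integral_mkcond.
have := @tuple_submean R n (coords w) s (fun t => f (cpoint t) ^+ 2) H s0.
rewrite coordsK expr2 normcM -expr2; apply.
- move=> t j ht; have dt : differentiable f (cpoint t).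
    by apply: hf; apply: wO; exact: tbox_cbox.
  have ut : cpoint (upd t j (cplx (tnth t j))) = cpoint t.
    by rewrite cpoint_upd subrK.
  have dc : differentiable (fun z : C => f (cpoint (upd t j z))) (cplx (tnth t j)).
    have -> : (fun z : C => f (cpoint (upd t j z))) = f \o (fun z : C =>
        (cpoint t - cplx (tnth t j) *: 'e_j) + z *: 'e_j).
      by apply/funext => z /=; rewrite cpoint_upd.
    apply: differentiable_comp; first exact: diff_line.
    by rewrite subrK.
  have -> : (fun z : C => f (cpoint (upd t j z)) ^+ 2) =
      (fun z : C => f (cpoint (upd t j z)) * f (cpoint (upd t j z))).
    by apply/funext => z; rewrite expr2.
  exact: differentiableM.
- apply/(measurable_restrictT _ mD); exact: measurable_normc2.
- by move=> t; rewrite /H patchE; case: ifP => // _; rewrite lee_fin sqr_ge0.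
- move=> t /tbox_cbox/wO Dt; rewrite /H patchE mem_set//.
  by rewrite expr2 normcM -expr2.
Qed.

(** [taylor_estimate] on the complex line through w in direction u.  The slope it
provides is the differential, because both approximate f to first order at w. *)
Lemma taylor_line f w u (s M : R) : 0 < s -> rnorm u <= 1 ->
  (forall v, cbox w s v -> differentiable f v) ->
  (forall v, cbox w s v -> normc (f v) <= M) ->
  normc ('d f w u) <= 8 * M / s /\
  forall t : C, normc t <= s / 4 ->
    normc (f (w + t *: u) - f w - t * 'd f w u) <= 32 * M / s ^+ 2 * normc t ^+ 2.
Proof.
move=> s0 u1 df fM.
have s20 : 0 < s / 2 by rewrite divr_gt0.
have inb (t : C) : onsq 0 (s / 2) t -> cbox w s (w + t *: u).
  rewrite /onsq subr0 => /andP[t1 t2] j; rewrite /onsq !mxE.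
  have -> : w ord0 j + t * u ord0 j - w ord0 j = t * u ord0 j by ring.
  have b : normc (t * u ord0 j) <= s.
    rewrite normcM -[s]mulr1; apply: ler_pM; rewrite ?normc_ge0//.
      by apply: le_trans (normc_le_ReIm _) _; apply: le_trans (lerD t1 t2) _; lra.
    exact: le_trans (rnorm_coord _ _) u1.
  by rewrite (le_trans (normc_Re _) b) (le_trans (normc_Im _) b).
have w_in : cbox w s w.
  by move=> j; rewrite /onsq subrr /= normr0 ltW.
pose g (t : C) := f (w + t *: u).
have dg t : onsq 0 (s / 2) t -> differentiable g t.
  move=> ht; have -> : g = f \o (fun a : C => w + a *: u) by [].
  by apply: differentiable_comp; [exact: diff_line|exact/df/inb].
have [L LB HL] := taylor_estimate s20 dg (fun t ht => fM _ (inb t ht)).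
have g0 : g 0 = f w by rewrite /g scale0r addr0.
have M0 : 0 <= M := le_trans (normc_ge0 _) (fM w w_in).
have HL' t : normc t <= s / 4 ->
    normc (f (w + t *: u) - f w - t * L) <= 32 * M / s ^+ 2 * normc t ^+ 2.
  move=> ts; have := HL t; rewrite subr0 g0 [L * t]mulrC.
  have -> : 8 * M / (s / 2) ^+ 2 = 32 * M / s ^+ 2 by field; rewrite gt_eqF.
  by apply; lra.
suff dL : 'd f w u = L.
  rewrite dL; split => //; apply: le_trans LB _.
  by rewrite le_eqVlt; apply/orP; left; apply/eqP; field; rewrite gt_eqF.
apply/eqP; rewrite -subr_eq0 -normc_eq0 eq_le normc_ge0 andbT.
apply/ler_addgt0Pr => e e0; rewrite add0r.
have [d d0 Hd] := diff_eps (df w w_in) (divr_gt0 e0 (ltr0n _ 2)).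
set K := 32 * M / s ^+ 2 in HL'.
have K0 : 0 <= K by rewrite /K !mulr_ge0 ?invr_ge0 ?sqr_ge0.
pose t : R := Num.min (Num.min (s / 4) (d / 2)) (e / 2 / (K + 1)).
have K1 : 0 < K + 1 by rewrite ltr_wpDl.
have t0 : 0 < t by rewrite /t !lt_min !divr_gt0.
have [t1 t2 t3] : [/\ t <= s / 4, t <= d / 2 & t <= e / 2 / (K + 1)].
  by rewrite /t; split; rewrite !ge_min lexx ?orbT.
have nt : normc t%:C = t by rewrite normc_real gtr0_norm.
have rt : rnorm (t%:C *: u) <= t.
  by rewrite rnormZ nt -[leRHS]mulr1 ler_pM2l.
have E1 : normc (f (w + t%:C *: u) - f w - t%:C * 'd f w u) <= e / 2 * t.
  have hd : `|t%:C *: u| < d%:C.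
    by rewrite rnormE ltcR; apply: le_lt_trans rt _; lra.
  have dZ : 'd f w (t%:C *: u) = t%:C * 'd f w u by rewrite linearZ.
  have h := Hd _ hd; rewrite [_ + w]addrC dZ rnormE in h.
  have h' : normc (f (w + t%:C *: u) - f w - t%:C * 'd f w u) <=
      e / 2 * rnorm (t%:C *: u).
    by rewrite -lecR rmorphM; exact: h.
  by apply: le_trans h' _; rewrite ler_wpM2l//; lra.
have E2 := HL' t%:C; rewrite nt in E2; have {}E2 := E2 t1.
have : t * normc ('d f w u - L) <= e / 2 * t + K * t ^+ 2.
  rewrite -{1}nt -normcM.
  have -> : t%:C * ('d f w u - L) =
     (f (w + t%:C *: u) - f w - t%:C * L) -
     (f (w + t%:C *: u) - f w - t%:C * 'd f w u) by ring.
  by apply: le_trans (le_normcB _ _) _; rewrite addrC lerD.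
have -> : e / 2 * t + K * t ^+ 2 = t * (e / 2 + K * t) by ring.
rewrite ler_pM2l// => /le_trans; apply.
have : K * t <= e / 2.
  rewrite ler_pdivlMr// in t3; nra.
lra.
Qed.

Lemma taylor_vec f w (s M : R) : 0 < s ->
  (forall v, cbox w s v -> differentiable f v) ->
  (forall v, cbox w s v -> normc (f v) <= M) ->
  (forall u, normc ('d f w u) <= 8 * M / s * rnorm u) /\
  forall v, rnorm v <= s / 4 ->
    normc (f (w + v) - f w - 'd f w v) <= 32 * M / s ^+ 2 * rnorm v ^+ 2.
Proof.
move=> s0 df fM.
have scale u : u != 0 -> exists2 u1, rnorm u1 <= 1 & u = (rnorm u)%:C *: u1.
  move=> u0; have r0 : 0 < rnorm u.
    by rewrite lt_def rnorm_ge0 andbT; apply: contraNneq u0 => /rnorm_eq0 ->.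
  exists ((rnorm u)^-1%:C *: u).
    by rewrite rnormZ normc_real gtr0_norm ?invr_gt0// mulVf// gt_eqF.
  by rewrite scalerA -rmorphM mulfV ?gt_eqF// scale1r.
have nr u : normc (rnorm u)%:C = rnorm u by rewrite normc_real ger0_norm// rnorm_ge0.
split=> [u|v vs].
  have [->|/scale[u1 h1 uE]] := eqVneq u 0.
    by rewrite linear0 normc0 /rnorm normr0 /= mulr0.
  have [h _] := taylor_line s0 h1 df fM.
  have -> : 'd f w u = (rnorm u)%:C * 'd f w u1 by rewrite [in LHS]uE linearZ.
  by rewrite normcM nr mulrC ler_wpM2r// rnorm_ge0.
have [->|/scale[u1 h1 vE]] := eqVneq v 0.
  by rewrite linear0 addr0 subrr subr0 normc0 /rnorm normr0 /= expr0n mulr0.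
have [_ h] := taylor_line s0 h1 df fM.
have -> : 'd f w v = (rnorm v)%:C * 'd f w u1 by rewrite [in LHS]vE linearZ.
have := h (rnorm v)%:C; rewrite nr -vE; exact.
Qed.

Lemma cbox_sub w v (s : R) : cbox w (s / 2) v -> cbox v (s / 2) `<=` cbox w s.
Proof.
move=> wv x vx j; have /andP[a1 a2] := wv j; have /andP[b1 b2] := vx j.
rewrite /onsq; have -> : x ord0 j - w ord0 j =
  (x ord0 j - v ord0 j) + (v ord0 j - w ord0 j) by ring.
have reD (p q : C) : `|complex.Re (p + q)| <= `|complex.Re p| + `|complex.Re q|.
  by rewrite raddfD; exact: ler_normD.
have imD (p q : C) : `|complex.Im (p + q)| <= `|complex.Im p| + `|complex.Im q|.
  by rewrite raddfD; exact: ler_normD.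
apply/andP; split; [apply: le_trans (reD _ _) _|apply: le_trans (imD _ _) _].
  by apply: le_trans (lerD b1 a1) _; lra.
by apply: le_trans (lerD b2 a2) _; lra.
Qed.

Lemma cbox_rnorm w v (s : R) : rnorm (v - w) <= s -> cbox w s v.
Proof.
move=> h j; have := rnorm_coord (v - w) j; rewrite !mxE => h'.
have {h'}h := le_trans h' h.
by rewrite /onsq (le_trans (normc_Re _) h) (le_trans (normc_Im _) h).
Qed.

(** Boxes of one size around all points near w stay inside Omega, so one constant
serves for all these points. *)
Lemma local_sup Omega w : open Omega -> Omega w ->
  exists2 s : R, 0 < s & exists2 K : R, 0 <= K &
    cbox w s `<=` Omega /\
    forall f (B : R), holomorphic Omega f -> (sqnorm Omega f <= B%:E)%E ->
      forall v, cbox w s v -> normc (f v) <= Num.sqrt (K * B).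
Proof.
move=> oO Ow; have [s s0 wO] := open_cbox oO Ow.
have s20 : 0 < s / 2 by rewrite divr_gt0.
exists (s / 2) => //; exists ((8 / (s / 2) ^+ 2) ^+ n).
  by rewrite exprn_ge0// divr_ge0// sqr_ge0.
split=> [v hv|f B hf fB v hv].
  by apply: wO => j; have /andP[h1 h2] := hv j; rewrite /onsq; lra.
have hs := cbox_sub hv.
have := eval_bound oO hf s20 (subset_trans hs wO) => h.
rewrite -(ger0_norm (normc_ge0 (f v))) -sqrtr_sqr ler_wsqrtr//.
rewrite -lee_fin (le_trans h)// EFinM lee_wpmul2l// lee_fin.
by rewrite exprn_ge0// divr_ge0// sqr_ge0.
Qed.

(** [eval_bound] near the point, and then the first part of [taylor_vec]. *)
Lemma deriv_bound Omega w : open Omega -> Omega w ->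
  exists2 K : R, 0 <= K & forall f (B : R), holomorphic Omega f ->
    (sqnorm Omega f <= B%:E)%E -> forall u,
    normc (f w) <= K * Num.sqrt B /\ normc ('d f w u) <= K * Num.sqrt B * rnorm u.
Proof.
move=> oO Ow; have [s s0 [K K0 [wO H]]] := local_sup oO Ow.
exists (Num.sqrt K * (1 + 8 / s)).
  by rewrite mulr_ge0 ?sqrtr_ge0// addr_ge0// divr_ge0// ltW.
move=> f B hf fB u; have fM := H f B hf fB.
have KB : Num.sqrt (K * B) = Num.sqrt K * Num.sqrt B by rewrite sqrtrM.
have w_in : cbox w s w by move=> j; rewrite /onsq subrr /= normr0 ltW.
have p0 : 0 <= Num.sqrt K * Num.sqrt B by rewrite mulr_ge0 ?sqrtr_ge0.
have s8 : 0 <= 8 / s by rewrite divr_ge0// ltW.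
split.
  apply: le_trans (fM w w_in) _; rewrite KB mulrAC ler_peMr//; lra.
have [h _] := taylor_vec s0 (fun v hv => hf v (wO v hv)) fM.
apply: le_trans (h u) _; rewrite ler_wpM2r ?rnorm_ge0// KB.
have -> : 8 * (Num.sqrt K * Num.sqrt B) / s = Num.sqrt K * Num.sqrt B * (8 / s) by ring.
by rewrite [leRHS]mulrAC ler_wpM2l//; lra.
Qed.

Lemma bounded_linear_cont (L : {linear Cn -> C}) (K : R) : 0 <= K ->
  (forall u, normc (L u) <= K * rnorm u) -> continuous L.
Proof.
move=> K0 LB x A /nbhs_ballP[e /= /gt0_realc[eE e0] HA]; apply/nbhs_ballP.
have K1 : 0 < K + 1 by rewrite ltr_wpDl.
exists (complex.Re e / (K + 1))%:C; first by rewrite /= ltcR divr_gt0.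
move=> y; rewrite -ball_normE /= rnormE ltcR ltr_pdivlMr// => xy.
have h : normc (L x - L y) < complex.Re e.
  have -> : L x - L y = L (x - y) by rewrite linearB.
  apply: le_lt_trans (LB _) _; apply: le_lt_trans _ xy.
  by rewrite mulrC ler_wpM2l ?rnorm_ge0// lerDl.
by apply: HA; rewrite -ball_normE /= norm_normc eE ltcR; exact: h.
Qed.

(** The estimate of [taylor_vec] for F k has constants independent of k, so it
survives the passage to the limit, with the limit of the differentials in the
place of the differential. *)
Lemma holo_limit Omega (F : nat -> Cn -> C) (G : Cn -> C) (B : R) :
  open Omega -> (forall k, holomorphic Omega (F k)) ->
  (forall k, (sqnorm Omega (F k) <= B%:E)%E) ->
  (forall w, Omega w -> ctends (fun k => F k w) (G w)) ->
  (forall w u, Omega w -> ccauchy (fun k => 'd (F k) w u)) ->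
  holomorphic Omega G.
Proof.
move=> oO hF FB FG dF w Ow. have [s s0 [K K0 [wO H]]] := local_sup oO Ow.
set M := Num.sqrt (K * B) in H.
have TV k := taylor_vec s0 (fun v hv => hF k v (wO v hv)) (H _ _ (hF k) (FB k)).
have /choice[L0 HL0] u : exists l, ctends (fun k => 'd (F k) w u) l.
  by apply: ccauchy_tends; exact: dF.
have lin : linear L0.
  move=> a u v; apply: ctends_unique (HL0 _) _.
  have := ctends_lin a (HL0 u) (HL0 v); congr (ctends _ _).
  by apply/funext => k; rewrite linearP.
pose L : {linear Cn -> C} := HB.pack_for {linear Cn -> C} L0
  (GRing.isLinear.Build C Cn C _ L0 lin).
have LB u : normc (L u) <= 8 * M / s * rnorm u.
  by apply: ctends_bound (HL0 u) _ => //= k; have [] := TV k.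
have w_in : cbox w s w by move=> j; rewrite /onsq subrr /= normr0 ltW.
have M0 : 0 <= M := le_trans (normc_ge0 _) (H _ _ (hF 0%N) (FB 0%N) w w_in).
have cL : continuous L.
  by apply: (bounded_linear_cont (K := 8 * M / s)); rewrite ?LB// !mulr_ge0 ?invr_ge0// ltW.
set K2 := 32 * M / s ^+ 2.
have K20 : 0 <= K2 by rewrite /K2 !mulr_ge0 ?invr_ge0 ?sqr_ge0.
have quad v : rnorm v <= s / 4 ->
    normc (G (v + w) - G w - L v) <= K2 * rnorm v ^+ 2.
  move=> vs; have Owv : Omega (w + v).
    by apply: wO; apply: cbox_rnorm; rewrite addrC addKr; lra.
  have lim : ctends (fun k => F k (w + v) - F k w - 'd (F k) w v)
      (G (v + w) - G w - L v).
    have := ctends_lin (-1) (HL0 v) (ctends_lin (-1) (FG w Ow) (FG _ Owv)).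
    rewrite [v + w]addrC; congr (ctends _ _); last by rewrite /=; ring.
    by apply/funext => k; ring.
  by apply: ctends_bound lim _ => // k; have [_] := TV k; exact.
suff [] : differentiable G w /\ 'd G w = L :> (Cn -> C) by [].
apply: (eps_diff cL).
move=> e e0; have K1 : 0 < K2 + 1 by rewrite ltr_wpDl.
exists (Num.min (s / 4) (e / (K2 + 1))); first by rewrite lt_min !divr_gt0.
move=> v; rewrite rnormE ltcR lt_min => /andP[v1 v2].
have h : normc (G (v + w) - G w - L v) <= e * rnorm v.
  apply: le_trans (quad v (ltW v1)) _.
  rewrite expr2 mulrA ler_wpM2r ?rnorm_ge0//.
  have := ltW v2; rewrite ler_pdivlMr// => h; apply: le_trans _ h.
  by rewrite mulrC ler_wpM2l ?rnorm_ge0// lerDl.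
by rewrite -lecR rmorphM in h; exact: h.
Qed.

End SeveralVariables.

(** * The inner product of the Bergman space *)

Section BergmanInnerProduct.
Variables (R : realType) (n : nat) (Omega : set 'rV[R[i]]_n).
Notation C := R[i].
Notation Cn := 'rV[R[i]]_n.
Notation plane := (measurableTypeR R * measurableTypeR R)%type.
Notation mu := (@vol R n).
Notation D := (@cpoint R n @^-1` Omega).
Hypothesis oO : open Omega.
Implicit Types (f g k : Cn -> C) (u v w : Cn) (a : C).

Let mD : measurable D := open_cpoint_measurable oO.

Lemma L2norm_sqr f : (L2norm Omega f `^ 2 = sqnorm Omega f)%E.
Proof.
rewrite /L2norm powR_Lnorm ?pnatr_eq0// /sqnorm [RHS]integral_mkcond.
apply: eq_integral => t _ /=; rewrite !patchE.
case: ifP => _ /=; last by rewrite normr0 powR0// pnatr_eq0.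
by rewrite ger0_norm ?normc_ge0// powR_mulrn// normc_ge0.
Qed.

(** The L^2 norm is a power of an integral in the extended reals; this reduces it to
a real square root, or to an infinite integral. *)
Lemma L2norm_cases f :
  (exists x : R, [/\ 0 <= x, L2norm Omega f = x%:E & sqnorm Omega f = (x ^+ 2)%:E]) \/
  (L2norm Omega f = +oo%E /\ sqnorm Omega f = +oo%E).
Proof.
have N0 : (0 <= L2norm Omega f)%E by rewrite /L2norm Lnorm_ge0.
rewrite -L2norm_sqr; case: (L2norm Omega f) N0 => [x|//|//].
  rewrite lee_fin => x0; left; exists x; split => //.
  by rewrite poweR_EFin powR_mulrn.
by move=> _; right; rewrite poweRyr// pnatr_eq0.
Qed.

Definition nrm2 f : R := fine (sqnorm Omega f).

Lemma sqnorm_ge0 f : (0 <= sqnorm Omega f)%E.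
Proof. by apply: integral_ge0 => t _; rewrite lee_fin sqr_ge0. Qed.

Lemma nrm2_ge0 f : 0 <= nrm2 f.
Proof. by rewrite fine_ge0// sqnorm_ge0. Qed.

(** Holomorphic functions are continuous, hence measurable. *)
Lemma A2P f : A2 Omega f <-> holomorphic Omega f /\ (sqnorm Omega f < +oo)%E.
Proof.
split=> [[[_ _ N] hf]|[hf Sf]]; split => //.
  by case: (L2norm_cases f) => [[x [_ _ ->]]|[h _]]; [exact: ltry|rewrite h in N].
have [m1 m2] := holo_measurable oO hf; split => //.
by case: (L2norm_cases f) => [[x [_ -> _]]|[_ h]]; [exact: ltry|rewrite h in Sf].
Qed.

Lemma nrm2E f : A2 Omega f -> sqnorm Omega f = (nrm2 f)%:E.
Proof. by move=> /A2P[_ h]; rewrite fineK// ge0_fin_numE ?sqnorm_ge0. Qed.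

Lemma L2normE f : A2 Omega f -> L2norm Omega f = (Num.sqrt (nrm2 f))%:E.
Proof.
move=> Af; have := nrm2E Af.
case: (L2norm_cases f) => [[x [x0 -> ->]]|[_ ->]//] -[<-].
by rewrite sqrtr_sqr ger0_norm.
Qed.

Lemma holo_lin a f g : holomorphic Omega f -> holomorphic Omega g ->
  holomorphic Omega (fun w => a * f w + g w).
Proof.
move=> hf hg w Ow; apply: differentiableD; last exact: hg.
by apply: differentiableM; [exact: differentiable_cst|exact: hf].
Qed.

Lemma normc_sqr_lin a (x y : C) :
  normc (a * x + y) ^+ 2 <= 2 * normc a ^+ 2 * normc x ^+ 2 + 2 * normc y ^+ 2.
Proof.
have h := le_normcD (a * x) y; rewrite normcM in h.
have h0 := normc_ge0 (a * x + y).
have h1 : normc (a * x + y) ^+ 2 <= (normc a * normc x + normc y) ^+ 2.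
  by rewrite ler_pXn2r// nnegrE// addr_ge0 ?mulr_ge0 ?normc_ge0.
apply: le_trans h1 _.
have := sqr_ge0 (normc a * normc x - normc y); nra.
Qed.

Lemma sqnorm_lin a f g : holomorphic Omega f -> holomorphic Omega g ->
  (sqnorm Omega (fun w => (a * f w + g w)%R) <=
   (2 * normc a ^+ 2)%:E * sqnorm Omega f + 2%:E * sqnorm Omega g)%E.
Proof.
move=> hf hg; have mf := measurable_normc2 oO hf; have mg := measurable_normc2 oO hg.
have mfg := measurable_normc2 oO (holo_lin a hf hg).
have a0 : 0 <= 2 * normc a ^+ 2 by rewrite mulr_ge0// sqr_ge0.
rewrite /sqnorm -!ge0_integralZl//; try by move=> *; rewrite lee_fin ?sqr_ge0.
rewrite -ge0_integralD//; last 4 first.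
- by move=> t _; rewrite mule_ge0// lee_fin// sqr_ge0.
- exact: measurable_funeM.
- by move=> t _; rewrite mule_ge0// lee_fin// sqr_ge0.
- exact: measurable_funeM.
apply: ge0_le_integral => //.
- by move=> t _; rewrite lee_fin sqr_ge0.
- by apply: emeasurable_funD; exact: measurable_funeM.
- by move=> t _; rewrite -!EFinM -EFinD lee_fin normc_sqr_lin.
Qed.

Lemma A2_lin a f g : A2 Omega f -> A2 Omega g ->
  A2 Omega (fun w => a * f w + g w).
Proof.
move=> Af Ag; have [hf _] := (A2P f).1 Af; have [hg _] := (A2P g).1 Ag.
apply/A2P; split; first exact: holo_lin.
apply: le_lt_trans (sqnorm_lin a hf hg) _.
by rewrite (nrm2E Af) (nrm2E Ag) -!EFinM -EFinD ltry.
Qed.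

Definition hprod f g (t : n.-tuple plane) : C :=
  f (cpoint t) * (g (cpoint t))^*%C.

Lemma hprod_int f g : A2 Omega f -> A2 Omega g ->
  mu.-integrable D (EFin \o (fun t => complex.Re (hprod f g t))) /\
  mu.-integrable D (EFin \o (fun t => complex.Im (hprod f g t))).
Proof.
move=> Af Ag; have [hf Sf] := (A2P f).1 Af; have [hg Sg] := (A2P g).1 Ag.
have [f1 f2] := holo_measurable oO hf; have [g1 g2] := holo_measurable oO hg.
have mf := measurable_normc2 oO hf; have mg := measurable_normc2 oO hg.
have sq_int k : measurable_fun D (fun t => (normc (k (cpoint t)) ^+ 2)%:E) ->
    (sqnorm Omega k < +oo)%E ->
    mu.-integrable D (fun t => (normc (k (cpoint t)) ^+ 2)%:E).
  move=> mk Sk; apply/integrableP; split => //.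
  rewrite (_ : (\int[_]_(_ in _) _)%E = sqnorm Omega k)//.
  by apply: eq_integral => t _; rewrite /= ger0_norm// sqr_ge0.
have dom := integrableD mD (sq_int _ mf Sf) (sq_int _ mg Sg).
have bnd t : normc (hprod f g t) <= normc (f (cpoint t)) ^+ 2 + normc (g (cpoint t)) ^+ 2.
  rewrite /hprod normcM normc_conj.
  have := normc_ge0 (f (cpoint t)); have := normc_ge0 (g (cpoint t)); nra.
split.
  apply: (le_integrable mD _ _ dom) => [|t _].
    apply/measurable_EFinP.
    rewrite (_ : (fun t => _) = (fun t =>
      complex.Re (f (cpoint t)) * complex.Re (g (cpoint t)) +
      complex.Im (f (cpoint t)) * complex.Im (g (cpoint t)))).
      by apply: measurable_funD; exact: measurable_funM.
    by apply/funext => t; rewrite /hprod; case: (f _) (g _) => [? ?] [? ?] /=; ring.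
  rewrite /= lee_fin [leRHS]ger0_norm ?addr_ge0 ?sqr_ge0//.
  exact: le_trans (normc_Re _) (bnd t).
apply: (le_integrable mD _ _ dom) => [|t _].
  apply/measurable_EFinP.
  rewrite (_ : (fun t => _) = (fun t =>
    complex.Im (f (cpoint t)) * complex.Re (g (cpoint t)) -
    complex.Re (f (cpoint t)) * complex.Im (g (cpoint t)))).
    by apply: measurable_funB; exact: measurable_funM.
  by apply/funext => t; rewrite /hprod; case: (f _) (g _) => [? ?] [? ?] /=; ring.
rewrite /= lee_fin [leRHS]ger0_norm ?addr_ge0 ?sqr_ge0//.
exact: le_trans (normc_Im _) (bnd t).
Qed.

Local Notation ip := (L2dot Omega).

Lemma ipE f g : ip f g = (\int[mu]_(t in D) complex.Re (hprod f g t)) +i*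
  (\int[mu]_(t in D) complex.Im (hprod f g t)).
Proof. by []. Qed.

Lemma ip_linl a f g k : A2 Omega f -> A2 Omega g -> A2 Omega k ->
  ip (fun w => a * f w + g w) k = a * ip f k + ip g k.
Proof.
move=> Af Ag Ak; have [i1 i2] := hprod_int Af Ak; have [i3 i4] := hprod_int Ag Ak.
have iZ (c : R) (h : n.-tuple plane -> R) : mu.-integrable D (EFin \o h) ->
    mu.-integrable D (EFin \o (fun t => c * h t)).
  by move=> ih; exact: (integrableZl mD c ih).
rewrite !ipE; case: a => a1 a2; rewrite [in RHS]/GRing.mul [in RHS]/GRing.add /=.
congr (_ +i* _).
  rewrite -!RintegralZl// -RintegralB//; [|exact: iZ|exact: iZ].
  rewrite -RintegralD//; last exact: (integrableB mD (iZ a1 _ i1) (iZ a2 _ i2)).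
  apply: eq_Rintegral => t _; rewrite /hprod.
  by case: (f _) (g _) (k _) => [? ?] [? ?] [? ?] /=; ring.
rewrite -!RintegralZl// -RintegralD//; [|exact: iZ|exact: iZ].
rewrite -RintegralD//; last exact: (integrableD mD (iZ a1 _ i2) (iZ a2 _ i1)).
apply: eq_Rintegral => t _; rewrite /hprod.
by case: (f _) (g _) (k _) => [? ?] [? ?] [? ?] /=; ring.
Qed.

Lemma ip_conj f g : A2 Omega f -> A2 Omega g -> ip g f = (ip f g)^*%C.
Proof.
move=> Af Ag; have [i1 i2] := hprod_int Af Ag.
rewrite !ipE /=; congr (_ +i* _).
  by apply: eq_Rintegral => t _; rewrite /hprod; case: (f _) (g _) => [? ?] [? ?] /=; ring.
rewrite -mulN1r -RintegralZl//.
by apply: eq_Rintegral => t _; rewrite /hprod; case: (f _) (g _) => [? ?] [? ?] /=; ring.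
Qed.

Lemma Rintegral_zero : \int[mu]_(t in D) (cst 0 t : R) = 0.
Proof. by rewrite /Rintegral integral0. Qed.

Lemma ip_self f : ip f f = (nrm2 f)%:C.
Proof.
rewrite ipE /nrm2 /sqnorm; congr (_ +i* _).
  apply: eq_Rintegral => t _; rewrite normc_sqr /hprod.
  by case: (f _) => ? ? /=; ring.
rewrite (@eq_Rintegral _ _ _ _ _ (cst 0)); first exact: Rintegral_zero.
by move=> t _; rewrite /hprod; case: (f _) => ? ? /=; ring.
Qed.

Lemma nrm2_eq0 f : A2 Omega f -> nrm2 f = 0 -> forall w, Omega w -> f w = 0.
Proof.
move=> Af f0 w Ow; have [hf _] := (A2P f).1 Af.
have [K _ /(_ f 0 hf)] := deriv_bound oO Ow.
rewrite (nrm2E Af) f0 => /(_ (lexx _) 0)[+ _].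
rewrite sqrtr0 mulr0 => h; apply: eq0_normc; apply/eqP.
by rewrite eq_le h normc_ge0.
Qed.

Lemma ip_linr a f g k : A2 Omega f -> A2 Omega g -> A2 Omega k ->
  ip k (fun w => a * f w + g w) = a^*%C * ip k f + ip k g.
Proof.
move=> Af Ag Ak; rewrite (ip_conj (A2_lin a Af Ag) Ak) ip_linl//.
by rewrite conjcD conjcM -(ip_conj Af Ak) -(ip_conj Ag Ak).
Qed.

Lemma nrm2_lin a f g : A2 Omega f -> A2 Omega g ->
  (nrm2 (fun w => a * f w + g w))%:C =
  (normc a ^+ 2 * nrm2 f)%:C + (a * ip f g + (a * ip f g)^*%C) + (nrm2 g)%:C.
Proof.
move=> Af Ag; have Afg := A2_lin a Af Ag.
rewrite -ip_self ip_linl// !ip_linr// !ip_self (ip_conj Af Ag) conjcM.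
have -> : (normc a ^+ 2 * nrm2 f)%:C = a * a^*%C * (nrm2 f)%:C.
  by rewrite mulc_conj -rmorphM.
by ring.
Qed.

(** The squared norm of a f + g is nonnegative at its minimum, attained at
a = - conj <f,g> / ||f||^2. *)
Lemma cauchy_schwarz f g : A2 Omega f -> A2 Omega g ->
  normc (ip f g) ^+ 2 <= nrm2 f * nrm2 g.
Proof.
move=> Af Ag; have [f0|f0] := eqVneq (nrm2 f) 0.
  have fz := nrm2_eq0 Af f0.
  have -> : ip f g = 0.
    rewrite ipE (@eq_Rintegral _ _ _ _ _ (cst 0)).
      rewrite (@eq_Rintegral _ _ _ _ _ (cst 0)); first by rewrite Rintegral_zero.
      by move=> t /set_mem /= h; rewrite /hprod fz// mul0r.
    by move=> t /set_mem /= h; rewrite /hprod fz// mul0r.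
  by rewrite f0 mul0r normc0 expr0n.
have fp : 0 < nrm2 f by rewrite lt_def f0 nrm2_ge0.
set p := ip f g; pose a : C := - p^*%C * ((nrm2 f)^-1)%:C.
have := nrm2_lin a Af Ag; rewrite -/p.
have -> : a * p = (- (normc p ^+ 2 / nrm2 f))%:C.
  rewrite /a mulrAC mulNr [p^*%C * p]mulrC mulc_conj -rmorphN -rmorphM.
  by congr (_ %:C); rewrite mulNr.
have -> : normc a ^+ 2 * nrm2 f = normc p ^+ 2 / nrm2 f.
  rewrite /a normcM normcN normc_conj normc_real ger0_norm ?invr_ge0 ?nrm2_ge0//.
  by field.
move=> /(f_equal (fun z => complex.Re z)) /= h.
have := nrm2_ge0 (fun w => a * f w + g w); rewrite h => h'.
have : normc p ^+ 2 / nrm2 f <= nrm2 g by lra.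
by rewrite ler_pdivrMr// mulrC.
Qed.

End BergmanInnerProduct.

(** * Representing bounded functionals by kernels *)

Section Riesz.
Variables (R : realType) (n : nat) (Omega : set 'rV[R[i]]_n).
Notation C := R[i].
Notation Cn := 'rV[R[i]]_n.
Notation plane := (measurableTypeR R * measurableTypeR R)%type.
Notation mu := (@vol R n).
Notation D := (@cpoint R n @^-1` Omega).
Hypothesis oO : open Omega.
Implicit Types (f g : Cn -> C) (u v w : Cn) (a : C).
Local Notation ip := (L2dot Omega).
Local Notation nrm := (nrm2 Omega).

Let mD : measurable D := open_cpoint_measurable oO.

Lemma ctends_normc2 (u : nat -> C) (l : C) : ctends u l ->
  (fun k => (normc (u k) ^+ 2)%:E) @ \oo --> (normc l ^+ 2)%:E.
Proof.
move=> ul; apply: cvg_EFin; first exact: nearW.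
have cn : (fun k => normc (u k)) @ \oo --> normc l.
  apply/cvgrPdist_lt => e e0; have [N HN] := ul e e0.
  exists N => // k /= /HN h; apply: le_lt_trans h.
  have h1 := le_normcD (u k) (l - u k); rewrite [u k + _]addrC subrK in h1.
  have h2 := le_normcD l (u k - l); rewrite [l + _]addrC subrK in h2.
  by rewrite distcC in h1; rewrite ler_norml; lra.
exact: cvgM.
Qed.

(** With H k = F k - F N for a Cauchy sequence F, this bounds the distance from F N
to the pointwise limit. *)
Lemma sqnorm_fatou (H : nat -> Cn -> C) (G : Cn -> C) (e : R) (N : nat) :
  (forall k, holomorphic Omega (H k)) ->
  (forall w, Omega w -> ctends (fun k => H k w) (G w)) ->
  (forall k, (N <= k)%N -> (sqnorm Omega (H k) <= e%:E)%E) ->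
  (sqnorm Omega G <= e%:E)%E.
Proof.
move=> hH HG He.
pose f (k : nat) (t : n.-tuple plane) := (normc (H (k + N)%N (cpoint t)) ^+ 2)%:E.
have lim t : D t -> limn_einf (f ^~ t) = (normc (G (cpoint t)) ^+ 2)%:E.
  move=> Dt; have ct : ctends (fun k => H (k + N)%N (cpoint t)) (G (cpoint t)).
    move=> d d0; have [M HM] := HG _ Dt d d0.
    by exists M => k Mk; apply: HM; rewrite (leq_trans Mk)// leq_addr.
  by have [-> _] := cvg_limn_einf_sup (ctends_normc2 ct).
have -> : sqnorm Omega G = (\int[mu]_(t in D) limn_einf (f ^~ t))%E.
  by apply: eq_integral => t /set_mem /= h; rewrite lim.
have mf k : measurable_fun D (f k) by exact: (measurable_normc2 oO (hH _)).
have f0 k t : D t -> (0 <= f k t)%E by rewrite lee_fin sqr_ge0.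
apply: le_trans (fatou mu mD mf f0) _.
rewrite limn_einf_lim; apply: lime_le; first exact: is_cvg_einfs.
apply: nearW => k; apply: le_trans (He (k + N)%N (leq_addl _ _)).
by apply: ereal_inf_lbound; exists k => //=.
Qed.

Lemma holo_cst a : holomorphic Omega (fun _ => a).
Proof. by move=> w _; exact: differentiable_cst. Qed.

Lemma A2_0 : A2 Omega (fun _ => 0).
Proof.
apply/(A2P oO); split; first exact: holo_cst.
rewrite /sqnorm; under eq_integral do rewrite normc0 expr0n /=.
by rewrite integral0.
Qed.

Lemma nrm2_0 : nrm (fun _ => 0) = 0.
Proof.
rewrite /nrm2 /sqnorm; under eq_integral do rewrite normc0 expr0n /=.
by rewrite integral0.
Qed.

Lemma ip_0l g : ip (fun _ => 0) g = 0.
Proof.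
rewrite ipE; apply/eqP; rewrite eq_complex /=; apply/andP; split; apply/eqP;
  rewrite -[RHS](@Rintegral_zero R n Omega);
  by apply: eq_Rintegral => t _; rewrite /hprod mul0r.
Qed.

Lemma diff_lincomb a f g w u : differentiable f w -> differentiable g w ->
  'd (fun v => a * f v + g v) w u = a * 'd f w u + 'd g w u.
Proof.
move=> df dg.
have dZ : differentiable (a *: f : Cn -> C) w.
  by exact: (@differentiableZ _ _ _ f a w df).
have E1 := @diffD _ _ _ (a *: f : Cn -> C) g w dZ dg.
have E2 := @diffZ _ _ _ f a w df.
have F1 := f_equal (fun l => l u) E1.
have F2 := f_equal (fun l => l u) E2.
etransitivity; first exact F1.
exact (f_equal (fun x => x + 'd g w u) F2).
Qed.

Variable h : nat -> Cn -> C.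
Hypothesis hh : complete_orthonormal_basis Omega h.

Let Ah j : A2 Omega (h j). Proof. by have [H _ _] := hh. Qed.
Let hE j k : ip (h j) (h k) = (j == k)%:R. Proof. by have [_ H _] := hh. Qed.

Section Combinations.
Variable a : nat -> C.

(** Partial sums of the series of the a_j h_j; the recursive form makes closure and
inner products immediate by induction. *)
Fixpoint comb N : Cn -> C :=
  if N is M.+1 then fun w => a M * h M w + comb M w else fun=> 0.

Lemma combE N w : comb N w = \sum_(0 <= j < N) a j * h j w.
Proof.
elim: N => [|N IH] /=; first by rewrite big_geq.
by rewrite big_nat_recr//= IH addrC.
Qed.

Lemma A2_comb N : A2 Omega (comb N).
Proof. by elim: N => [|N IH]; [exact: A2_0|exact: (A2_lin oO)]. Qed.

Lemma ip_comb_h N j : ip (comb N) (h j) = if (j < N)%N then a j else 0.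
Proof.
elim: N => [|N IH] /=; first by rewrite ip_0l.
rewrite (ip_linl oO)//; last exact: A2_comb.
rewrite hE IH ltnS; have [->|jN] := eqVneq N j.
  by rewrite ltnn leqnn mulr1 addr0.
by rewrite mulr0 add0r [in RHS]leq_eqVlt eq_sym (negbTE jN).
Qed.

Lemma nrm2_h j : nrm (h j) = 1.
Proof.
by have := ip_self Omega (h j); rewrite hE eqxx => /(f_equal (fun z => complex.Re z)) /= <-.
Qed.

Lemma nrm2_combS N : nrm (comb N.+1) = normc (a N) ^+ 2 + nrm (comb N).
Proof.
have := nrm2_lin oO (a N) (Ah N) (A2_comb N).
have z : ip (h N) (comb N) = 0.
  by rewrite (ip_conj oO (A2_comb N) (Ah N)) ip_comb_h ltnn rmorph0.
rewrite z mulr0 rmorph0 !addr0 nrm2_h mulr1.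
by move=> /(f_equal (fun z => complex.Re z)).
Qed.

Lemma ip_comb N M : (N <= M)%N -> ip (comb N) (comb M) = (nrm (comb N))%:C.
Proof.
move=> /subnKC <-; elim: (M - N)%N => [|k IH]; first by rewrite addn0 ip_self.
rewrite addnS /= (ip_linr oO)//; try exact: A2_comb.
by rewrite ip_comb_h ltnNge leq_addr /= mulr0 add0r.
Qed.

Lemma nrm2_combB N M : (N <= M)%N ->
  nrm (fun w => -1 * comb N w + comb M w) = nrm (comb M) - nrm (comb N).
Proof.
move=> NM; have := nrm2_lin oO (-1) (A2_comb N) (A2_comb M).
rewrite ip_comb// normcN normc1 expr1n mul1r.
by move=> /(f_equal (fun z => complex.Re z)); rewrite /= => ->; ring.
Qed.

Lemma nrm2_comb_mono N M : (N <= M)%N -> nrm (comb N) <= nrm (comb M).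
Proof. by move=> NM; rewrite -subr_ge0 -nrm2_combB// nrm2_ge0. Qed.

End Combinations.

Variables (l : (Cn -> C) -> C) (K : R).
Hypothesis K0 : 0 <= K.
Hypothesis l_lin : forall a f g, A2 Omega f -> A2 Omega g ->
  l (fun w => a * f w + g w) = a * l f + l g.
Hypothesis l_bound : forall f, A2 Omega f -> normc (l f) <= K * Num.sqrt (nrm f).

Let l0 : l (fun=> 0) = 0.
Proof.
have := l_bound A2_0; rewrite nrm2_0 sqrtr0 mulr0 => h0.
by apply: eq0_normc; apply/eqP; rewrite eq_le h0 normc_ge0.
Qed.

Let a j : C := (l (h j))^*%C.

Let l_comb N : l (comb a N) = (nrm (comb a N))%:C.
Proof.
elim: N => [|N IH]; first by rewrite /= l0 nrm2_0.
rewrite nrm2_combS /= l_lin//; last exact: A2_comb.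
by rewrite IH rmorphD /= -mulc_conj /a; congr (_ + _); rewrite conjcK mulrC.
Qed.

Let comb_le N : nrm (comb a N) <= K ^+ 2.
Proof.
have := l_bound (A2_comb a N); rewrite l_comb normc_real ger0_norm ?nrm2_ge0//.
have s0 := sqrtr_ge0 (nrm (comb a N)).
have := sqr_sqrtr (nrm2_ge0 Omega (comb a N)).
move: (Num.sqrt _) s0 => s s0 <- hs.
have [->|sp] := eqVneq s 0; first by rewrite expr0n sqr_ge0.
rewrite ler_pXn2r// -(ler_pM2r (_ : 0 < s)) -?expr2//.
by rewrite lt_def sp.
Qed.

Let comb_cauchy (e : R) : 0 < e -> exists N, forall k j, (N <= k)%N -> (N <= j)%N ->
  nrm (fun w => -1 * comb a k w + comb a j w) < e.
Proof.
move=> e0; pose S := range (fun N => nrm (comb a N)).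
have hS : has_sup S.
  split; first by exists (nrm (comb a 0)); exists 0%N.
  by exists (K ^+ 2) => _ [N _ <-].
have [_ [N _ <-] HN] := sup_adherent e0 hS.
have ubS k : nrm (comb a k) <= sup S.
  by apply: ub_le_sup; [exact: hS.2|exists k].
have key k j : (N <= k)%N -> (k <= j)%N ->
    nrm (fun w => -1 * comb a k w + comb a j w) < e.
  move=> Nk kj; rewrite nrm2_combB//.
  by have := nrm2_comb_mono a Nk; have := ubS j; lra.
exists N => k j Nk Nj; have [kj|jk] := leqP k j; first exact: key.
have <- : nrm (fun w => -1 * comb a j w + comb a k w) =
    nrm (fun w => -1 * comb a k w + comb a j w).
  rewrite /nrm2 /sqnorm; congr fine; apply: eq_integral => t _.
  by rewrite -[in LHS]normcN; congr ((normc _ ^+ 2)%:E); ring.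
exact: key (ltnW jk).
Qed.

Let G w : C := limn (series (fun j => h j w * a j)).

Let GE w l' : ctends (fun N => comb a N w) l' -> G w = l'.
Proof.
move=> /ctends_limn <-; rewrite /G.
have -> : series (fun j => h j w * a j) = (fun N => comb a N w); last by [].
apply/funext => N; rewrite /series /= combE.
by apply: eq_bigr => j _; rewrite mulrC.
Qed.

Let comb_diff w u k j : Omega w ->
  comb a j w - comb a k w = -1 * comb a k w + comb a j w /\
  'd (comb a j) w u - 'd (comb a k) w u =
   'd (fun v => -1 * comb a k v + comb a j v) w u.
Proof.
move=> Ow; split; first by ring.
have [h1 _] := (A2P oO _).1 (A2_comb a k); have [h2 _] := (A2P oO _).1 (A2_comb a j).
have sub_lin (x y : C) : x - y = -1 * y + x by ring.
exact (etrans (sub_lin _ _) (esym (diff_lincomb (-1) u (h1 w Ow) (h2 w Ow)))).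
Qed.

Let comb_ccauchy w u : Omega w -> ccauchy (fun N => comb a N w) /\
  ccauchy (fun N => 'd (comb a N) w u).
Proof.
move=> Ow; have [B B0 HB] := deriv_bound oO Ow.
have key e : 0 < e -> exists N, forall k j, (N <= k)%N -> (N <= j)%N ->
    normc (comb a j w - comb a k w) < e /\
    normc ('d (comb a j) w u - 'd (comb a k) w u) < e.
  move=> e0; pose c := B * (1 + rnorm u) + 1.
  have r0 := rnorm_ge0 u.
  have c0 : 0 < c by rewrite /c ltr_wpDl// mulr_ge0// addr_ge0.
  have ec : 0 < (e / c) ^+ 2 by rewrite exprn_gt0// divr_gt0.
  have [N HN] := comb_cauchy ec; exists N => k j Nk Nj.
  set d := fun v => -1 * comb a k v + comb a j v.
  have Ad : A2 Omega d by apply: (A2_lin oO); exact: A2_comb.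
  have [hd _] := (A2P oO _).1 Ad.
  have [h1 h2] := HB d (nrm d) hd ltac:(by rewrite (nrm2E oO Ad)) u.
  have [E1 E2] := comb_diff u k j Ow.
  have sd : Num.sqrt (nrm d) < e / c.
    rewrite -[e / c]ger0_norm ?divr_ge0 ?ltW// -sqrtr_sqr ltr_sqrt//.
    exact: HN.
  have sdc : Num.sqrt (nrm d) * c < e by rewrite -ltr_pdivlMr.
  have s0 := sqrtr_ge0 (nrm d).
  rewrite E1 E2; split.
    apply: le_lt_trans h1 _; apply: le_lt_trans _ sdc.
    by rewrite mulrC ler_wpM2l// /c; nra.
  apply: le_lt_trans h2 _; apply: le_lt_trans _ sdc.
  by rewrite mulrAC mulrC ler_wpM2l// /c; nra.
by split=> e e0; have [N HN] := key e e0; exists N => k j Nk Nj;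
  have [? ?] := HN j k Nj Nk.
Qed.

Let G_lim w : Omega w -> ctends (fun N => comb a N w) (G w).
Proof.
move=> Ow; have [cc _] := comb_ccauchy 0 Ow; have [x hx] := ccauchy_tends cc.
by rewrite (GE hx).
Qed.

Let h_comb N : holomorphic Omega (comb a N).
Proof. by have [] := (A2P oO _).1 (A2_comb a N). Qed.

Let A2_G : A2 Omega G.
Proof.
have SB N : (sqnorm Omega (comb a N) <= (K ^+ 2)%:E)%E.
  by rewrite (nrm2E oO (A2_comb a N)) lee_fin.
apply/(A2P oO); split.
  apply: (holo_limit oO h_comb SB G_lim) => w u Ow.
  by have [] := comb_ccauchy u Ow.
by apply: le_lt_trans (sqnorm_fatou (N := 0) h_comb G_lim (fun k _ => SB k)) (ltry _).
Qed.

Let nrm2_G : nrm G <= K ^+ 2.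
Proof.
rewrite -lee_fin -(nrm2E oO A2_G).
apply: (sqnorm_fatou (N := 0) h_comb G_lim) => k _.
by rewrite (nrm2E oO (A2_comb a k)) lee_fin.
Qed.

Let comb_tends (e : R) : 0 < e -> exists N, forall k, (N <= k)%N ->
  nrm (fun w => -1 * comb a k w + G w) <= e.
Proof.
move=> e0; have [N HN] := comb_cauchy e0; exists N => k Nk.
have Ad : A2 Omega (fun w => -1 * comb a k w + G w).
  by apply: (A2_lin oO) => //; exact: A2_comb.
rewrite -lee_fin -(nrm2E oO Ad).
apply: (@sqnorm_fatou (fun j w => -1 * comb a k w + comb a j w) _ e N).
- by move=> j; exact: (holo_lin (-1) (h_comb k) (h_comb j)).
- move=> w Ow d d0; have [M HM] := G_lim Ow d0; exists M => j /HM.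
  by rewrite opprD addrACA subrr add0r.
- move=> j Nj; have Aj : A2 Omega (fun w => -1 * comb a k w + comb a j w).
    by apply: (A2_lin oO); exact: A2_comb.
  by rewrite (nrm2E oO Aj) lee_fin ltW// HN.
Qed.

Let ip_h_G j : ip (h j) G = l (h j).
Proof.
apply/eqP; rewrite -subr_eq0 -normc_eq0 eq_le normc_ge0 andbT.
apply/ler_addgt0Pr => e e0; rewrite add0r.
have [N HN] := comb_tends (exprn_gt0 2 e0).
pose k := maxn N j.+1.
have Ad : A2 Omega (fun w => -1 * comb a k w + G w).
  by apply: (A2_lin oO) => //; exact: A2_comb.
have := cauchy_schwarz oO (Ah j) Ad.
rewrite (ip_linr oO) ?A2_comb//; last exact: A2_comb.
rewrite (ip_conj oO (A2_comb a k) (Ah j)) ip_comb_h leq_maxr /a conjcK nrm2_h mul1r.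
have -> : (-1 : C)^*%C = -1 by rewrite rmorphN rmorph1.
rewrite mulN1r addrC => /le_trans /(_ (HN k (leq_maxl _ _))).
by rewrite ler_pXn2r// nnegrE ?normc_ge0// ltW.
Qed.

Let ip_comb_G b N : ip (comb b N) G = l (comb b N).
Proof.
elim: N => [|N IH] /=; first by rewrite ip_0l l0.
by rewrite (ip_linl oO) ?l_lin ?ip_h_G ?IH//; exact: A2_comb.
Qed.

(** With a_j = conj(l(h_j)), the partial sums F_N satisfy l(F_N) = ||F_N||^2, so the
bound on l gives ||F_N|| <= K and the sums converge in norm to a member G of the
space.  The identity <f,G> = l(f) holds for f = h_j by continuity, then for
combinations, then for all f because combinations are dense. *)
Lemma riesz : A2 Omega (fun w => limn (series (fun j => h j w * (l (h j))^*%C))) /\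
  forall f, A2 Omega f ->
    ip f (fun w => limn (series (fun j => h j w * (l (h j))^*%C))) = l f.
Proof.
split=> [|f Af]; first exact: A2_G.
change (ip f G = l f).
apply/eqP; rewrite -subr_eq0 -normc_eq0 eq_le normc_ge0 andbT.
apply/ler_addgt0Pr => e e0; rewrite add0r.
have K1 : 0 < 2 * K + 1 by rewrite ltr_wpDl// mulr_ge0.
have [_ _ /(_ f Af _ (divr_gt0 e0 K1))[N [b Hb]]] := hh.
pose r w := -1 * comb b N w + f w.
have Ar : A2 Omega r by apply: (A2_lin oO) => //; exact: A2_comb.
have sr : Num.sqrt (nrm r) < e / (2 * K + 1).
  rewrite -lte_fin -(L2normE oO Ar); apply: le_lt_trans Hb.
  rewrite le_eqVlt; apply/orP; left; apply/eqP; congr (L2norm _ _).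
  by apply/funext => w; rewrite /r combE mulN1r addrC.
have -> : ip f G - l f = ip r G - l r.
  rewrite /r (ip_linl oO) ?l_lin ?ip_comb_G//; try exact: A2_comb.
  by ring.
have s0 := sqrtr_ge0 (nrm r).
have i1 : normc (ip r G) <= Num.sqrt (nrm r) * K.
  have := cauchy_schwarz oO Ar A2_G => cs.
  rewrite -[leLHS]ger0_norm ?normc_ge0// -sqrtr_sqr.
  have -> : K = Num.sqrt (K ^+ 2) by rewrite sqrtr_sqr ger0_norm.
  rewrite -sqrtrM ?nrm2_ge0//; apply: ler_wsqrtr; apply: le_trans cs _.
  by rewrite ler_wpM2l ?nrm2_ge0.
have i2 := l_bound Ar.
apply: le_trans (le_normcB _ _) _.
move: sr; rewrite ltr_pdivlMr// => sr; nra.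
Qed.

End Riesz.

(** * The Bergman and Caratheodory metrics *)

Section Metrics.
Variables (R : realType) (n : nat) (Omega : set 'rV[R[i]]_n).
Notation C := R[i].
Notation Cn := 'rV[R[i]]_n.
Implicit Types (f g : Cn -> C) (u v w z X : Cn) (a : C).
Local Notation ip := (L2dot Omega).
Local Notation nrm := (nrm2 Omega).

Lemma realc_neq0 (x : R) : 0 < x -> x%:C != 0.
Proof. by move=> x0; rewrite -normc_gt0 normc_real gtr0_norm. Qed.

Lemma tangentE X f z : differentiable f z -> tangent X f z = 'd f z X.
Proof.
move=> df; rewrite /tangent.
have -> : 'd f z X = \sum_(j < n) X ord0 j * 'd f z ('e_j).
  rewrite [in LHS](row_sum_delta X) linear_sum; apply: eq_bigr => j _.
  by rewrite linearZ.
by apply: eq_bigr => j _; rewrite deriveE.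
Qed.

Lemma tangent_lin X a f g z : differentiable f z -> differentiable g z ->
  tangent X (fun w => a * f w + g w) z = a * tangent X f z + tangent X g z.
Proof.
move=> df dg; rewrite (tangentE X df) (tangentE X dg).
have dfg : differentiable (fun w => a * f w + g w) z.
  apply: differentiableD; last exact: dg.
  by apply: differentiableM; [exact: differentiable_cst|exact: df].
exact (etrans (tangentE X dfg) (diff_lincomb a X df dg)).
Qed.

Lemma tangentM X f g z : differentiable f z -> differentiable g z ->
  tangent X (fun w => f w * g w) z = f z * tangent X g z + g z * tangent X f z.
Proof.
move=> df dg; rewrite (tangentE X df) (tangentE X dg).
have dfg : differentiable (fun w => f w * g w) z by exact: differentiableM.
have E := f_equal (fun l => l X) (diffM df dg).
exact (etrans (tangentE X dfg) E).
Qed.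

Hypothesis hOmega : bounded_domain Omega.
Let oO : open Omega. Proof. by case: hOmega. Qed.

Lemma bounded_domain_rnorm : exists2 M : R, 0 <= M &
  forall w, Omega w -> rnorm w <= M.
Proof.
have [_ _ [w0 Ow0] [M [Mr HM]]] := hOmega.
have ME : M = (complex.Re M)%:C.
  by move: Mr; rewrite realE; case: (M) => x y; rewrite !lecE /= => /orP[]/andP[/eqP h _];
    rewrite ?h // -?h.
have key w : Omega w -> rnorm w <= complex.Re M + 1.
  have MM : M < (complex.Re M + 1)%:C by rewrite {1}ME ltcR ltrDl.
  by move=> /(HM _ MM); rewrite /= rnormE lecR.
exists (complex.Re M + 1) => //.
exact: le_trans (rnorm_ge0 w0) (key w0 Ow0).
Qed.

(** A bounded domain is contained in a box, and boxes have finite volume. *)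
Lemma A2_one : A2 Omega (fun=> 1).
Proof.
have [M M0 HM] := bounded_domain_rnorm.
apply/(A2P oO); split; first exact: holo_cst.
rewrite /sqnorm; under eq_integral do rewrite normc1 expr1n.
rewrite integral_cst ?mul1e; last exact: open_cpoint_measurable.
apply: le_lt_trans (tbox_finite (coords 0) M0).
apply: le_measure; rewrite ?inE.
- exact: open_cpoint_measurable.
- exact: measurable_tbox.
- move=> t /= /HM h j; rewrite tnth_mktuple /= mxE /= !subr0.
  have := rnorm_coord (cpoint t) j; rewrite cpointE => hj.
  have {}hj := le_trans hj h.
  by split; [exact: le_trans (normc_Re _) hj|exact: le_trans (normc_Im _) hj].
Qed.

(** The derivative estimate of [taylor_vec] applies with bound 1.  Without an upper
bound the supremum would be 0 by convention. *)
Lemma caratheodory_bounded z X : Omega z ->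
  has_ubound [set normc (tangent X f z) | f in
        [set f | [/\ holomorphic Omega f, f z = 0
                   & forall w, Omega w -> normc (f w) < 1]]].
Proof.
move=> Oz; have [s s0 zO] := open_cbox oO Oz.
exists (8 * 1 / s * rnorm X) => _ [f [hf _ f1] <-].
rewrite (tangentE X (hf z Oz)).
have [h _] := taylor_vec s0 (fun v hv => hf v (zO v hv))
  (fun v hv => ltW (f1 v (zO v hv))).
exact: h.
Qed.

(** A multiple of w_j - z_j competes, for an index j with X_j nonzero. *)
Lemma caratheodory_gt0 z X : Omega z -> X != 0 ->
  0 < caratheodory_metric Omega z X.
Proof.
move=> Oz X0; have [M M0 HM] := bounded_domain_rnorm.
have [j Xj] : exists j, X ord0 j != 0.
  apply/existsP; apply: contraNT X0; rewrite negb_exists => /forallP H.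
  by apply/eqP/rowP => j; rewrite mxE; apply/eqP; have := H j; rewrite negbK.
pose e : R := (2 * M + 1)^-1.
have e0 : 0 < e by rewrite invr_gt0 ltr_wpDl// mulr_ge0.
pose L0 v : C := v ord0 j * e%:C.
have lin : linear L0.
  by move=> a u v; rewrite /L0 !mxE /GRing.scale /=; ring.
pose L : {linear Cn -> C} := HB.pack_for {linear Cn -> C} L0
  (GRing.isLinear.Build C Cn C _ L0 lin).
have cL : continuous L.
  apply: (bounded_linear_cont (K := e)); first exact: ltW.
  move=> u; rewrite /= /L0 normcM normc_real gtr0_norm// mulrC ler_pM2l//.
  exact: rnorm_coord.
pose f w : C := (w ord0 j - z ord0 j) * e%:C.
have fd w : differentiable f w /\ ('d f w = L :> (Cn -> C)).
  apply: eps_diff => // d d0; exists 1 => // v _.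
  have -> : f (v + w) - f w - L v = 0 by rewrite /f /= /L0 mxE; ring.
  by rewrite normr0 mulr_ge0// ?lecR ltW.
have tf : tangent X f z = X ord0 j * e%:C.
  have [d1 d2] := fd z.
  exact (etrans (tangentE X d1) (f_equal (fun l => l X) d2)).
have n0 : 0 < normc (tangent X f z).
  by rewrite tf normcM normc_real gtr0_norm// mulr_gt0// normc_gt0.
apply: lt_le_trans n0 _; apply: ub_le_sup; first exact: caratheodory_bounded.
exists f; [split|reflexivity].
- by move=> w _; have [] := fd w.
- by rewrite /f subrr mul0r.
- move=> w Ow; rewrite /f normcM normc_real gtr0_norm//.
  rewrite /e ltr_pdivrMr ?mul1r; last by rewrite ltr_wpDl// mulr_ge0.
  have h1 := le_trans (rnorm_coord w j) (HM w Ow).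
  have h2 := le_trans (rnorm_coord z j) (HM z Oz).
  apply: le_lt_trans (le_normcB _ _) _; lra.
Qed.

Section Kernel.
Variables (h : nat -> Cn -> C) (z X : Cn) (c : Cn -> C).
Hypothesis Oz : Omega z.
Hypothesis X0 : X != 0.
Hypothesis hh : complete_orthonormal_basis Omega h.

Let holoA f : A2 Omega f -> holomorphic Omega f.
Proof. by move=> /(A2P oO)[]. Qed.

Let diffA f : A2 Omega f -> differentiable f z.
Proof. by move=> /holoA; exact. Qed.

(** The reproducing property of the kernel: this is [riesz] for the evaluation at z. *)
Lemma kernel_spec : A2 Omega (fun w => bergman_kernel h w z) /\
  forall f, A2 Omega f -> ip f (fun w => bergman_kernel h w z) = f z.
Proof.
have [K K0 HK] := deriv_bound oO Oz.
apply: (@riesz R n Omega oO h hh (fun f => f z) K K0) => // f Af.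
by have [] := HK f (nrm f) (holoA Af) ltac:(by rewrite (nrm2E oO Af)) 0.
Qed.

Lemma deriv_kernel_spec : exists2 G, A2 Omega G &
  forall f, A2 Omega f -> ip f G = tangent X f z.
Proof.
have [K K0 HK] := deriv_bound oO Oz.
have Kr : 0 <= K * rnorm X by rewrite mulr_ge0// rnorm_ge0.
have bnd f : A2 Omega f -> normc (tangent X f z) <= K * rnorm X * Num.sqrt (nrm f).
  move=> Af; rewrite (tangentE X (diffA Af)) mulrAC.
  by have [] := HK f (nrm f) (holoA Af) ltac:(by rewrite (nrm2E oO Af)) X.
have [AG HG] := @riesz R n Omega oO h hh (fun f => tangent X f z) _ Kr
  (fun a f g Af Ag => tangent_lin X a (diffA Af) (diffA Ag)) bnd.
by exists (fun w => limn (series (fun j => h j w * (tangent X (h j) z)^*%C))).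
Qed.

Local Notation Kz := (fun w => bergman_kernel h w z).
Let AK : A2 Omega Kz := kernel_spec.1.
Let HKz := kernel_spec.2.

Lemma bergman_diagE : bergman_kernel h z z = (bergman_diag h z)%:C /\
  bergman_diag h z = nrm Kz.
Proof.
have E : bergman_kernel h z z = (nrm Kz)%:C by rewrite -(HKz AK) ip_self.
by rewrite /bergman_diag E.
Qed.

(** By Cauchy-Schwarz, because the constant 1 is in the space and takes the value 1
at z. *)
Lemma bergman_diag_gt0 : 0 < bergman_diag h z.
Proof.
rewrite bergman_diagE.2 lt_def nrm2_ge0 andbT; apply/eqP => k0.
have := cauchy_schwarz oO A2_one AK; rewrite (HKz A2_one) k0 mulr0 normc1 expr1n.
by rewrite ler10.
Qed.

Local Notation S := (S_space Omega z X).
Local Notation M := (orthocomplement Omega S).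

Let M_lin a f g : M f -> M g -> M (fun w => a * f w + g w).
Proof.
move=> [Af Hf] [Ag Hg]; split; first exact: (A2_lin oO).
move=> s Ss; have [As _ _] := Ss.
by rewrite (ip_linl oO)// Hf// Hg// mulr0 addr0.
Qed.

Let MK : M Kz.
Proof.
split=> [|s [As sz _]]; first exact: AK.
by rewrite (ip_conj oO As AK) (HKz As) sz rmorph0.
Qed.

Let ipC0 f g : A2 Omega f -> A2 Omega g -> ip f g = 0 -> ip g f = 0.
Proof. by move=> Af Ag H; rewrite (ip_conj oO Af Ag) H rmorph0. Qed.

(** The kernel and the derivative kernel both lie in the complement of S, and the
inner products with them are the value and the derivative at z. *)
Let S_of f : A2 Omega f -> (forall m, M m -> ip f m = 0) -> S f.
Proof.
move=> Af Hf; have [G AG HG] := deriv_kernel_spec.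
have MG : M G.
  split=> [|s [As _ sX]]; first exact: AG.
  by rewrite (ip_conj oO As AG) (HG _ As) sX rmorph0.
by split; rewrite -?(HKz Af) -?(HG _ Af)// Hf.
Qed.

(** Let G' be the part of the derivative kernel orthogonal to K(.,z).  Since f(z) = 0
means that f is orthogonal to K(.,z), the projection of f is its component along
G'.  If G' vanishes, so does the coefficient, by the convention x / 0 = 0. *)
Lemma projection_exists f : A2 Omega f -> f z = 0 ->
  exists p, M p /\ forall m, M m -> ip (fun w => f w - p w) m = 0.
Proof.
move=> Af fz; have [G AG HG] := deriv_kernel_spec.
have MG : M G.
  split=> [|s [As _ sX]]; first exact: AG.
  by rewrite (ip_conj oO As AG) (HG _ As) sX rmorph0.
have k0 := bergman_diag_gt0; rewrite bergman_diagE.2 in k0.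
pose G' w := - (ip G Kz / (nrm Kz)%:C) * bergman_kernel h w z + G w.
have MG' : M G' by exact: (M_lin _ _).
have [AG' _] := MG'.
have GK : ip G' Kz = 0.
  rewrite (ip_linl oO _ AK AG AK) ip_self mulNr divfK ?addNr//.
  exact: realc_neq0 k0.
pose p w := (ip f G' / (nrm G')%:C) * G' w + 0.
have M0 : M (fun=> 0).
  by split=> [|s _]; [exact: (A2_0 oO)|exact: ip_0l].
have Mp : M p by exact: (M_lin _ _).
have [Ap _] := Mp; exists p; split => // m [Am Hm].
pose r w := -1 * p w + f w.
have Ar : A2 Omega r by exact: (A2_lin oO).
have -> : (fun w => f w - p w) = r by apply/funext => w; rewrite /r mulN1r addrC.
have pE g : A2 Omega g -> ip p g = ip f G' / (nrm G')%:C * ip G' g.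
  by move=> Ag; rewrite (ip_linl oO _ AG' (A2_0 oO) Ag) ip_0l addr0.
have rK : ip r Kz = 0.
  by rewrite (ip_linl oO _ Ap Af AK) pE// GK mulr0 mulr0 add0r HKz.
have rG' : ip r G' = 0.
  rewrite (ip_linl oO _ Ap Af AG') pE// ip_self.
  have [g0|g0] := eqVneq (nrm G') 0.
    have := cauchy_schwarz oO Af AG'; rewrite g0 mulr0 => h0.
    have -> : ip f G' = 0.
      apply: eq0_normc; apply/eqP; rewrite -sqrf_eq0 eq_le h0 sqr_ge0 //.
    by rewrite !mul0r mulr0 addr0.
  rewrite divfK; first by rewrite mulN1r addNr.
  by apply/eqP => /complexI g00; rewrite g00 eqxx in g0.
have rG : ip r G = 0.
  have := rG'; rewrite (ip_linr oO _ AK AG Ar) rK mulr0 add0r; exact.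
apply: (ipC0 Am Ar); apply: Hm; split => //; [by rewrite -(HKz Ar)|by rewrite -(HG _ Ar)].
Qed.

Hypothesis hc : holomorphic Omega c.
Hypothesis hcz : c z = 0.
Hypothesis hc1 : forall w, Omega w -> normc (c w) < 1.
Hypothesis hcX : tangent X c z = (caratheodory_metric Omega z X)%:C.

Let kap := bergman_diag h z.
Let CX := caratheodory_metric Omega z X.
Let bc w := b_fun h z w * c w.
Let kap0 : 0 < kap. Proof. exact: bergman_diag_gt0. Qed.
Let skap0 : 0 < Num.sqrt kap. Proof. by rewrite sqrtr_gt0. Qed.

Let A_b : A2 Omega (b_fun h z).
Proof.
have := A2_lin oO ((Num.sqrt kap)%:C^-1) AK (A2_0 oO); congr (A2 _ _).
by apply/funext => w; rewrite addr0 mulrC.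
Qed.

Let A_bc : A2 Omega bc.
Proof.
have [hb Sb] := (A2P oO _).1 A_b.
have hbc : holomorphic Omega bc.
  by move=> w Ow; apply: differentiableM; [exact: hb|exact: hc].
apply/(A2P oO); split => //; apply: le_lt_trans Sb.
apply: ge0_le_integral.
- exact: open_cpoint_measurable.
- by move=> t _; rewrite lee_fin sqr_ge0.
- exact: (measurable_normc2 oO hbc).
- exact: (measurable_normc2 oO hb).
- move=> t /= Ot; rewrite lee_fin /bc normcM exprMn ler_piMr ?sqr_ge0//.
  by rewrite expr_le1// ?normc_ge0// ltW// hc1.
Qed.

Let bcz : bc z = 0. Proof. by rewrite /bc hcz mulr0. Qed.

Let bcX : tangent X bc z = (Num.sqrt kap * CX)%:C.
Proof.
have db := diffA A_b; have dc := hc Oz.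
rewrite (tangentM X db dc) hcz mul0r addr0 hcX rmorphM; congr (_ * _).
rewrite /b_fun bergman_diagE.1 -/kap.
have sk : (Num.sqrt kap)%:C != 0.
  exact: realc_neq0 skap0.
apply: (mulIf sk); rewrite divfK// -rmorphM -expr2 sqr_sqrtr// ltW//.
Qed.

(** Any element that satisfies the specification of the projection will do, so
nothing depends on how it was chosen. *)
Lemma bergman_metric_formula : bergman_metric Omega h z X =
  CX / fine (L2norm Omega (P_proj Omega z X bc)).
Proof.
have CX0 : 0 < CX := caratheodory_gt0 Oz X0.
set p := P_proj Omega z X bc.
have [Mp Hp] : M p /\ forall m, M m -> ip (fun w => bc w - p w) m = 0.
  exact: (xgetPex (cst 0) (projection_exists A_bc bcz)).
have [Ap pS] := Mp.
pose r w := -1 * p w + bc w.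
have Ar : A2 Omega r by exact: (A2_lin oO).
have rE : (fun w => bc w - p w) = r by apply/funext => w; rewrite /r mulN1r addrC.
rewrite rE in Hp.
have [_ rz rX] := S_of Ar Hp.
pose t0 := Num.sqrt kap * CX.
have t00 : 0 < t0 by rewrite mulr_gt0.
have pz : p z = 0.
  by move: rz; rewrite /r bcz addr0 mulN1r => /eqP; rewrite oppr_eq0 => /eqP.
have pX : tangent X p z = t0%:C.
  move: rX; rewrite (tangent_lin X (-1) (diffA Ap) (diffA A_bc)) bcX mulN1r.
  have opp_add0 (x y : C) : - x + y = 0 -> x = y.
    by rewrite addrC => /subr0_eq.
  by move=> /opp_add0.
have t0C : t0%:C != 0 by exact: realc_neq0 t00.
have N0 : 0 < nrm p.
  rewrite lt_def nrm2_ge0 andbT; apply/eqP => n0.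
  have [G AG HG] := deriv_kernel_spec.
  have := cauchy_schwarz oO Ap AG; rewrite (HG _ Ap) pX n0 mul0r normc_real.
  by rewrite real_normK ?num_real// leNgt exprn_gt0.
rewrite (L2normE oO Ap) /=.
set s := Num.sqrt (nrm p); have s0 : 0 < s by rewrite sqrtr_gt0.
have s2 : s ^+ 2 = nrm p by rewrite sqr_sqrtr ?nrm2_ge0.
rewrite /bergman_metric -/kap.
set E := [set _ | _ in _].
have Eub x : E x -> x <= t0 / s.
  move=> [f [hf fz f1] <-].
  have Af : A2 Omega f.
    apply/(A2P oO); split => //.
    by case: (L2norm_cases Omega f) => [[y [_ _ ->]]|[h0 _]]; [exact: ltry|rewrite h0 in f1].
  have nf : nrm f <= 1.
    have := L2normE oO Af; move: f1 => /[swap] -> ; rewrite lee_fin => f1.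
    rewrite -(sqr_sqrtr (nrm2_ge0 Omega f)) -(expr1n _ 2).
    by rewrite ler_pXn2r// nnegrE ?sqrtr_ge0.
  pose lm := tangent X f z / t0%:C.
  pose q w := - lm * p w + f w.
  have Aq : A2 Omega q by exact: (A2_lin oO).
  have Sq : S q.
    split; [exact: Aq|by rewrite /q pz fz mulr0 addr0|].
    apply: (etrans (tangent_lin X (- lm) (diffA Ap) (diffA Af))).
    have neg_div (a b : C) : b != 0 -> - (a / b) * b + a = 0.
      by move=> b0; rewrite mulNr divfK// addNr.
    by rewrite pX; exact: neg_div t0C.
  have fE : f = fun w => lm * p w + q w.
    by apply/funext => w; rewrite /q mulNr addNKr.
  have := nrm2_lin oO lm Ap Aq; rewrite -fE (pS _ Sq) mulr0 rmorph0 !addr0.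
  move=> /(f_equal (fun x => complex.Re x)) /= nfE.
  have nq := nrm2_ge0 Omega q.
  have : (normc lm * s) ^+ 2 <= 1 by rewrite exprMn s2; lra.
  rewrite expr_le1// ?mulr_ge0 ?normc_ge0 ?(ltW s0)//.
  rewrite /lm normcM normcV normc_real gtr0_norm// => h1.
  by rewrite ler_pdivlMr// -[leRHS]mul1r -ler_pdivrMr// mulrAC.
have Et : E (t0 / s).
  pose f w := (s^-1)%:C * p w + 0.
  have Af : A2 Omega f := A2_lin oO _ Ap (A2_0 oO).
  exists f.
    split; first exact: holoA.
      by rewrite /f pz mulr0 addr0.
    rewrite (L2normE oO Af) lee_fin.
    have := nrm2_lin oO (s^-1)%:C Ap (A2_0 oO).
    rewrite -/f nrm2_0 (ipC0 (A2_0 oO) Ap (ip_0l _ _)) mulr0 rmorph0 !addr0.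
    move=> /(f_equal (fun x => complex.Re x)) /= ->.
    rewrite normc_real gtr0_norm ?invr_gt0// -s2 -exprMn mulVf ?gt_eqF//.
    by rewrite expr1n sqrtr1.
  rewrite (tangent_lin X _ (diffA Ap) (diffA (A2_0 oO))) pX.
  have -> : tangent X (fun _ : Cn => 0 : C) z = 0.
    rewrite (tangentE X (diffA (A2_0 oO))).
    exact (f_equal (fun l => l X) (@diff_cst _ Cn C (0 : C) z)).
  have -> : (s^-1)%:C * t0%:C + 0 = (t0 / s)%:C by rewrite addr0 -rmorphM mulrC.
  by rewrite normc_real gtr0_norm// divr_gt0.
have -> : sup E = t0 / s.
  apply/eqP; rewrite eq_le; apply/andP; split.
    by apply: ge_sup; [exists (t0 / s)|exact: Eub].
  by apply: ub_le_sup => //; exists (t0 / s); exact: Eub.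
by rewrite /t0 -mulrA mulKf// gt_eqF.
Qed.

End Kernel.

End Metrics.

Theorem theorem1p1 (R : realType) (n : nat) (Omega : set 'rV[R[i]]_n)
    (z X : 'rV[R[i]]_n) (h : nat -> 'rV[R[i]]_n -> R[i])
    (c : 'rV[R[i]]_n -> R[i])
    (hOmega : bounded_domain Omega)
    (hz : Omega z)
    (hX : X != 0)
    (hh : complete_orthonormal_basis Omega h)
    (hc : holomorphic Omega c)
    (hcz : c z = 0)
    (hc1 : forall w, Omega w -> normc (c w) < 1)
    (hcX : tangent X c z = (caratheodory_metric Omega z X)%:C) :
  bergman_metric Omega h z X =
  caratheodory_metric Omega z X /
    fine (L2norm Omega (P_proj Omega z X (fun w => b_fun h z w * c w))).
Proof. exact: bergman_metric_formula. Qed.
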